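(* Let $B$ be a complex normed space with norm $\|\cdot\|_B$, for which there exist a locally compact Hausdorff space $X$, an extremely C-regular subspace $A$ of $C_0(X)$, bounded complex linear operators $\mathcal{I}\colon A\to B$, $\mathcal{D}\colon B\to A$, and a bounded complex linear functional $\mathcal{C}\colon B\to\mathbb{C}$ with the following properties: (i) $(\mathcal{D}\circ\mathcal{I})(f)=f$ for every $f\in A$; (ii) $(\mathcal{C}\circ\mathcal{I})(f)=0$ for every $f\in A$; (iii) $\|a\|_B=|\mathcal{C}(a)|+\|\mathcal{D}(a)\|_\infty$ for every $a\in B$; (iv) there exists $e\in\ker\mathcal{D}$ with $\mathcal{C}(e)=\|e\|_B=1$. If $\Delta\colon S_B\to S_B$ is a surjective isometry with respect to the norm $\|\cdot\|_B$, where $S_B=\{a\in B:\|a\|_B=1\}$, then $\Delta$ extends to a surjective real linear isometry from $B$ onto $B$.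
   Context: $C_0(X)$ is the Banach space of all complex-valued continuous functions on the locally compact Hausdorff space $X$ vanishing at infinity, with the supremum norm $\|f\|_\infty=\sup_{x\in X}|f(x)|$. Let $A$ be a complex linear subspace of $C_0(X)$, normed by $\|\cdot\|_\infty$ (not assumed closed), and let $S_A$ be its unit sphere. For $x\in X$, $\delta_x\colon A\to\mathbb{C}$ is $\delta_x(f)=f(x)$. The Choquet boundary $\operatorname{Ch}(A)$ is the set of all $x\in X$ for which $\delta_x$ is an extreme point of the closed unit ball of the dual space $A^*$. The subspace $A$ is extremely C-regular if for each $\varepsilon>0$, each $x\in\operatorname{Ch}(A)$ and each open neighborhood $O$ of $x$ in $X$ there exists $f\in S_A$ such that $f(x)=1$ and $|f|<\varepsilon$ on $X\setminus O$. An isometry on $S_B$ is a map preserving the distance $\|a-b\|_B$. *)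

(* Defs.v *)
(* The complex numbers are R[i], for an arbitrary [R : realType].  The norm of
   a normedModType over R[i] is R[i]-valued (with nonnegative real values). *)
From HB Require Import structures.
From mathcomp Require Import all_boot all_order all_algebra.
From mathcomp Require Import complex ring.
From mathcomp Require Import all_classical all_reals all_analysis.

Set Implicit Arguments.
Unset Strict Implicit.
Unset Printing Implicit Defensive.

Import Order.TTheory GRing.Theory Num.Theory.
Import numFieldNormedType.Exports.

Local Open Scope classical_set_scope.
Local Open Scope ring_scope.
Local Open Scope complex_scope.

Section Sup_norm.
Variables (R : realType) (T : Type).

(* The supremum is taken in R and is meaningful for u bounded on D; it is 0
   when D is empty. *)
Definition sup_norm (D : set T) (u : T -> R[i]) : R[i] :=
  (sup [set complex.Re `|u t| | t in D])%:C.

Implicit Types (D : set T) (u v : T -> R[i]).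

Lemma sup_norm_le D u (M : R[i]) :
  0 <= M -> (forall t, D t -> `|u t| <= M) -> sup_norm D u <= M.
Proof.
move=> M0 uM; rewrite /sup_norm -(RRe_real (ger0_real M0)) lecR.
have [->|/set0P[t Dt]] := eqVneq D set0.
  by rewrite image_set0 sup0 -lecR RRe_real ?ger0_real.
apply: ge_sup; first by exists (complex.Re `|u t|), t.
move=> _ [s Ds <-]; have := uM _ Ds.
by rewrite lecE => /andP[].
Qed.

Lemma le_sup_norm D u (M : R[i]) t :
  (forall s, D s -> `|u s| <= M) -> D t -> `|u t| <= sup_norm D u.
Proof.
move=> uM Dt; rewrite /sup_norm -[`|u t|](RRe_real (normr_real _)) lecR.
apply: ub_le_sup; last by exists t.
exists (complex.Re M) => _ [s Ds <-].
by have := uM _ Ds; rewrite lecE => /andP[].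
Qed.

Lemma sup_norm_ge0 D u : 0 <= sup_norm D u.
Proof.
rewrite /sup_norm ler0c.
set E := [set _ | t in D].
have E0 x : E x -> 0 <= x.
  by move=> [s _ <-]; have := normr_ge0 (u s); rewrite lecE => /andP[].
have [[[x Ex] Eb]|/sup_out ->//] := pselect (has_sup E).
exact: le_trans (E0 _ Ex) (ub_le_sup Eb Ex).
Qed.

Lemma sup_normD D u v (M N : R[i]) :
  (forall s, D s -> `|u s| <= M) -> (forall s, D s -> `|v s| <= N) ->
  sup_norm D (fun t => u t + v t) <= sup_norm D u + sup_norm D v.
Proof.
move=> uM vN; apply: sup_norm_le => [|t Dt]; first by rewrite addr_ge0 ?sup_norm_ge0.
rewrite (le_trans (ler_normD _ _))// lerD//; last exact: le_sup_norm vN Dt.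
exact: le_sup_norm uM Dt.
Qed.

Lemma sup_normZ D u (M : R[i]) (c : R[i]) :
  (forall s, D s -> `|u s| <= M) ->
  sup_norm D (fun t => c * u t) = `|c| * sup_norm D u.
Proof.
move=> uM; apply/le_anti/andP; split.
  apply: sup_norm_le => [|t Dt]; first by rewrite mulr_ge0 ?sup_norm_ge0.
  by rewrite normrM ler_wpM2l// (le_sup_norm uM).
have [->|c0] := eqVneq c 0; first by rewrite normr0 mul0r sup_norm_ge0.
have cp : 0 < `|c| by rewrite normr_gt0.
rewrite -ler_pdivlMl//; apply: sup_norm_le => [|t Dt].
  by rewrite mulr_ge0 ?sup_norm_ge0// invr_ge0.
rewrite ler_pdivlMl// -normrM.
apply: (@le_sup_norm D (fun t => c * u t) (`|c| * M) t) => // s Ds.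
by rewrite normrM ler_wpM2l// uM.
Qed.

End Sup_norm.

Section C0_space.
Variables (R : realType) (X : topologicalType).

Definition vanishing_at_infinity (f : X -> R[i]^o) :=
  forall e : R, 0 < e -> compact [set x | e%:C <= `|f x|].

Definition C0_pred : {pred X -> R[i]^o} :=
  [pred f | `[< continuous f /\ vanishing_at_infinity f >]].

Lemma normRe (z : R[i]^o) : `|z| = (complex.Re `|z|)%:C.
Proof. by rewrite RRe_real// normr_real. Qed.

Lemma Re_norm_continuous (f : X -> R[i]^o) :
  continuous f -> continuous (fun x => complex.Re `|f x|).
Proof.
move=> fc x; apply/(@cvgrPdist_lt R R^o) => r r0.
have /(@cvgrPdist_lt R[i] R[i]^o)/(_ r%:C) := fc x.
rewrite ltcR => /(_ r0); apply: filterS => y.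
rewrite -ltcR; apply: le_lt_trans.
have -> : (`|complex.Re `|f x| - complex.Re `|f y| |)%:C =
    `| `|f x| - `|f y| | :> R[i].
  rewrite [in RHS](normRe (f x)) [in RHS](normRe (f y)) -rmorphB.
  by rewrite [RHS]normc_def /= expr0n addr0 sqrtr_sqr.
exact: ler_dist_dist.
Qed.

Lemma C0_bounded (f : X -> R[i]^o) : f \in C0_pred ->
  exists M : R[i], forall x, setT x -> `|f x| <= M.
Proof.
move=> /asboolP[fc fv].
have := @continuous_compact X R^o _ _
  (continuous_subspaceT (Re_norm_continuous fc)) (fv 1 ltr01).
move=> /(@compact_bounded R R^o) /pinfty_ex_gt0[M M0 fM].
exists (1 + M)%:C => x _.
rewrite [`|f x|]normRe lecR.
have [x1|/ltW x1] := leP 1 (complex.Re `|f x|); last first.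
  by rewrite (le_trans x1)// lerDl ltW.
have /fM : [set complex.Re `|f x| | x in [set x | 1%:C <= `|f x|]]
    (complex.Re `|f x|).
  by exists x => //=; rewrite [`|f x|]normRe lecR.
by move=> /(le_trans (ler_norm _)) /le_trans; apply; rewrite lerDr.
Qed.

Lemma C0_submod_closed : submod_closed C0_pred.
Proof.
split.
- apply/asboolP; split; first exact: cst_continuous.
  move=> e e0; rewrite (_ : mkset _ = set0); first exact: compact0.
  apply/seteqP; split => // x /=.
  by rewrite normr0 -(rmorph0 (real_complex R)) lecR leNgt e0.
- move=> c f g /asboolP[fc fv] /asboolP[gc gv]; apply/asboolP.
  have hc : continuous (c *: f + g : X -> R[i]^o).
    move=> x; apply: (@cvgD _ _ _ _ _ (fun x => c *: f x) g); last exact: gc.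
    by apply: cvgZl_tmp; exact: fc.
  split=> // e e0.
  pose k : R := 1 + complex.Re `|c|.
  have c0 : 0 <= complex.Re `|c|.
    by have := normr_ge0 c; rewrite lecE => /andP[].
  have k0 : 0 < k by rewrite ltr_pwDl.
  pose d : R := e / 2 / k.
  have d0 : 0 < d by rewrite !divr_gt0.
  apply: (@subclosed_compact _ _
    ([set x | d%:C <= `|f x|] `|` [set x | d%:C <= `|g x|])).
  + have -> : [set x | e%:C <= `|(c *: f + g) x|] =
              (fun x => complex.Re `|(c *: f + g) x|) @^-1` [set y | e <= y].
      have eE (z : R[i]^o) : (e%:C <= `|z|) = (e <= complex.Re `|z|).
        by rewrite {1}normRe lecR.
      by apply/seteqP; split => x; rewrite /preimage /mkset eE.
    apply: preimage_closed; last exact: (@closed_ge R).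
    by move=> x _; exact: Re_norm_continuous.
  + exact: compactU (fv _ d0) (gv _ d0).
  + move=> x ex.
    have [dx|/negP fd] := pselect (d%:C <= `|f x|); [by left|right].
    have {}fd : `|f x| <= d%:C.
      have d0' : 0 <= d%:C by rewrite ler0c ltW.
      have /orP[//|h] := real_leVge (normr_real (f x)) (ger0_real d0').
      by rewrite h in fd.
    have : e%:C <= `|c| * d%:C + `|g x|.
      apply: (le_trans ex); apply: (le_trans (ler_normD _ _)).
      by rewrite lerD2r normrM ler_wpM2l.
    rewrite -lerBlDl; apply: le_trans.
    rewrite [`|c|]normRe -rmorphM -rmorphB lecR.
    have -> : e = d * k + d * k by rewrite /d divfK ?gt_eqF// -splitr.
    rewrite -subr_ge0 /k; move: (complex.Re _) c0 => r r0.
    have -> : d * (1 + r) + d * (1 + r) - r * d - d = d + r * d.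
      by ring.
    have {}d0 := ltW d0; apply: addr_ge0 => //. exact: mulr_ge0.
Qed.

HB.instance Definition _ :=
  GRing.isSubmodClosed.Build R[i] (X -> R[i]^o) C0_pred C0_submod_closed.

Record C0 := MkC0 { C0_fun :> X -> R[i]^o ; _ : C0_fun \in C0_pred }.

HB.instance Definition _ := [isSub of C0 for C0_fun].
HB.instance Definition _ := [Choice of C0 by <:].
HB.instance Definition _ := [SubChoice_isSubLmodule of C0 by <:].

Let C0_norm (f : C0) : R[i] := sup_norm setT f.

Let C0_normD (f g : C0) : C0_norm (f + g) <= C0_norm f + C0_norm g.
Proof.
have [M fM] := C0_bounded (valP f); have [N gN] := C0_bounded (valP g).
exact: sup_normD fM gN.
Qed.

Let C0_normZ (c : R[i]) (f : C0) : C0_norm (c *: f) = `|c| * C0_norm f.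
Proof. by have [M fM] := C0_bounded (valP f); exact: sup_normZ fM. Qed.

Let C0_norm_eq0 (f : C0) : C0_norm f = 0 -> f = 0.
Proof.
move=> f0; apply/val_inj/funext => x /=.
have [M fM] := C0_bounded (valP f).
by apply/eqP; rewrite -normr_le0 -f0; exact: le_sup_norm fM _.
Qed.

HB.instance Definition _ :=
  Lmodule_isNormed.Build R[i] C0 C0_normD C0_normZ C0_norm_eq0.

Lemma C0_normE (f : C0) : `|f| = sup_norm setT f.
Proof. by []. Qed.

Lemma C0_le_norm (f : C0) x : `|f x| <= `|f|.
Proof. by have [M fM] := C0_bounded (valP f); exact: le_sup_norm fM _. Qed.

End C0_space.

Section Subspace.
Variables (K : numFieldType) (V : normedModType K) (S : submodClosed V).

Record subspace_of := MkSubspace { subspace_val : V ; _ : subspace_val \in S }.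

HB.instance Definition _ := [isSub of subspace_of for subspace_val].
HB.instance Definition _ := [Choice of subspace_of by <:].
HB.instance Definition _ := [SubChoice_isSubLmodule of subspace_of by <:].

Let subspace_norm (f : subspace_of) : K := `|val f|.

Let subspace_normD f g :
  subspace_norm (f + g) <= subspace_norm f + subspace_norm g.
Proof. exact: ler_normD. Qed.

Let subspace_normZ (c : K) f : subspace_norm (c *: f) = `|c| * subspace_norm f.
Proof. exact: normrZ. Qed.

Let subspace_norm_eq0 f : subspace_norm f = 0 -> f = 0.
Proof. by move=> /normr0_eq0 f0; exact: val_inj. Qed.

HB.instance Definition _ := Lmodule_isNormed.Build K subspace_of
  subspace_normD subspace_normZ subspace_norm_eq0.

Lemma subspace_normE (f : subspace_of) : `|f| = `|val f|.
Proof. by []. Qed.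

End Subspace.

Section Balls.
Variables (K : numFieldType) (V : normedModType K).

Definition unit_sphere : set V := [set a | `|a| = 1].
Definition closed_unit_ball : set V := [set a | `|a| <= 1].

End Balls.
Arguments unit_sphere {K} V.
Arguments closed_unit_ball {K} V.

Section Dual.
Variables (R : realType) (V : normedModType R[i]).

(* For linear [phi], [bounded_near phi (nbhs 0)] is boundedness as an operator
   (lemma [linear_boundedP]). *)
Definition dual_pred : {pred V -> R[i]^o} :=
  [pred phi | `[< linear phi /\ bounded_near phi (nbhs (0 : V)) >]].

Lemma dual_bound (phi : V -> R[i]^o) : phi \in dual_pred ->
  exists2 M : R[i], 0 <= M & forall f, `|phi f| <= M * `|f|.
Proof.
move=> /asboolP[pl pb].
pose p : {linear V -> R[i]^o} :=
  HB.pack phi (GRing.isLinear.Build _ _ _ _ phi pl).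
have /(linear_boundedP p)/pinfty_ex_gt0[M M0 pM] := pb.
by exists M => //; exact: ltW.
Qed.

Lemma dual_bounded (phi : V -> R[i]^o) : phi \in dual_pred ->
  exists M : R[i], forall f, closed_unit_ball V f -> `|phi f| <= M.
Proof.
move=> /dual_bound[M M0 pM]; exists M => f f1.
by rewrite (le_trans (pM f))// ler_piMr.
Qed.

Lemma dual_predP (phi : V -> R[i]^o) (M : R[i]) : 0 <= M ->
  linear phi -> (forall f, `|phi f| <= M * `|f|) -> phi \in dual_pred.
Proof.
move=> M0 pl pM; apply/asboolP; split=> //.
pose p : {linear V -> R[i]^o} :=
  HB.pack phi (GRing.isLinear.Build _ _ _ _ phi pl).
apply/(linear_boundedP p); near=> r => f.
rewrite (le_trans (pM f))// ler_wpM2r//.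
by near: r; apply: nbhs_pinfty_ge; rewrite ger0_real.
Unshelve. all: by end_near. Qed.

Lemma dual_submod_closed : submod_closed dual_pred.
Proof.
split.
  apply: (@dual_predP _ 0) => // [c f g|f]; first by rewrite scaler0 addr0.
  by rewrite normr0 mul0r.
move=> c phi psi php psp.
have [M M0 pM] := dual_bound php; have [N N0 qN] := dual_bound psp.
move: php psp => /asboolP[pl _] /asboolP[ql _].
apply: (@dual_predP _ (`|c| * M + N)).
- by rewrite addr_ge0// mulr_ge0.
- move=> d f g; rewrite !fctE/= pl ql !scalerDr !scalerA [c * d]mulrC.
  by rewrite addrACA.
- move=> f; rewrite (le_trans (ler_normD _ _))// mulrDl lerD//.
  by rewrite normrM -mulrA ler_wpM2l.
Qed.

HB.instance Definition _ :=
  GRing.isSubmodClosed.Build R[i] (V -> R[i]^o) dual_pred dual_submod_closed.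

Record dual := MkDual { dual_fun :> V -> R[i]^o ; _ : dual_fun \in dual_pred }.

HB.instance Definition _ := [isSub of dual for dual_fun].
HB.instance Definition _ := [Choice of dual by <:].
HB.instance Definition _ := [SubChoice_isSubLmodule of dual by <:].

Let dual_norm (phi : dual) : R[i] := sup_norm (closed_unit_ball V) phi.

Let dual_normD (phi psi : dual) :
  dual_norm (phi + psi) <= dual_norm phi + dual_norm psi.
Proof.
have [M pM] := dual_bounded (valP phi); have [N qN] := dual_bounded (valP psi).
exact: sup_normD pM qN.
Qed.

Let dual_normZ (c : R[i]) (phi : dual) : dual_norm (c *: phi) = `|c| * dual_norm phi.
Proof. by have [M pM] := dual_bounded (valP phi); exact: sup_normZ pM. Qed.

Let dual_le_norm0 (phi : dual) f : `|phi f| <= dual_norm phi * `|f|.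
Proof.
have [M pM] := dual_bounded (valP phi).
have /asboolP[pl _] := valP phi.
pose p : {linear V -> R[i]^o} :=
  HB.pack (phi : V -> R[i]^o) (GRing.isLinear.Build _ _ _ _ (phi : V -> R[i]^o) pl).
have phi0 : phi 0 = 0 := linear0 p.
have phiZ (c : R[i]) g : phi (c *: g) = c * phi g by exact: (linearZ_LR p).
have [->|f0] := eqVneq f 0; first by rewrite phi0 !normr0 mulr0.
have fp : 0 < `|f| by rewrite normr_gt0.
have f1 : closed_unit_ball V (`|f|^-1 *: f).
  by rewrite /closed_unit_ball/= normrZ normfV normr_id mulVf// gt_eqF.
have : `|phi (`|f|^-1 *: f)| <= dual_norm phi := le_sup_norm pM f1.
by rewrite phiZ normrM normfV normr_id ler_pdivrMl// mulrC.
Qed.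

Let dual_norm_eq0 (phi : dual) : dual_norm phi = 0 -> phi = 0.
Proof.
move=> p0; apply/val_inj/funext => f /=; apply/eqP; rewrite -normr_le0.
by have := dual_le_norm0 phi f; rewrite p0 mul0r.
Qed.

HB.instance Definition _ :=
  Lmodule_isNormed.Build R[i] dual dual_normD dual_normZ dual_norm_eq0.

Lemma dual_normE (phi : dual) : `|phi| = sup_norm (closed_unit_ball V) phi.
Proof. by []. Qed.

Lemma dual_le_norm (phi : dual) f : `|phi f| <= `|phi| * `|f|.
Proof. exact: dual_le_norm0. Qed.

End Dual.

(* Also for K = R[i]: [0 < t] forces [t] to be real. *)
Definition extreme_point (K : numDomainType) (E : lmodType K) (S : set E) (x : E) :=
  S x /\ forall (y z : E) (t : K), S y -> S z -> 0 < t -> t < 1 ->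
    x = t *: y + (1 - t) *: z -> y = x /\ z = x.

Section Choquet.
Variables (R : realType) (X : topologicalType) (A : submodClosed (C0 R X)).
Local Notation A_ := (subspace_of A).

Lemma delta_dual (x : X) :
  (fun f : A_ => val f x : R[i]^o) \in @dual_pred R A_.
Proof.
apply: (@dual_predP R A_ _ 1); first exact: ler01.
  by move=> c f g; rewrite (linearP (val : A_ -> C0 R X)).
by move=> f; rewrite mul1r; exact: C0_le_norm.
Qed.

Definition delta (x : X) : dual A_ := MkDual (delta_dual x).

Definition choquet_boundary : set X :=
  [set x | extreme_point (closed_unit_ball (dual A_)) (delta x)].

Definition extremely_C_regular : Prop :=
  forall (e : R) (x : X) (O : set X),
    0 < e -> choquet_boundary x -> open O -> O x ->
    exists f : A_, [/\ unit_sphere A_ f, val f x = 1 &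
      forall y, (~` O) y -> `|val f y| < e%:C].

End Choquet.

Section Maps.
Variables (R : realType) (B : normedModType R[i]).

(* [unit_sphere B] is coerced to the corresponding subtype of [B]. *)
Definition sphere_isometry (Delta : unit_sphere B -> unit_sphere B) : Prop :=
  forall a b, `|val (Delta a) - val (Delta b)| = `|val a - val b|.

Definition real_linear (F : B -> B) : Prop :=
  forall (r : R) (a b : B), F (r%:C *: a + b) = r%:C *: F a + F b.

Definition is_isometry (F : B -> B) : Prop :=
  forall a b, `|F a - F b| = `|a - b|.

End Maps.

Definition is_surjective (T U : Type) (f : T -> U) : Prop :=
  forall u, exists t, f t = u.

(* Main.v *)
Require Import Defs.
From HB Require Import structures.
From mathcomp Require Import all_boot all_order all_algebra.
From mathcomp Require Import complex ring lra.
From mathcomp Require Import all_classical all_reals all_analysis.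

Set Implicit Arguments.
Unset Strict Implicit.
Unset Printing Implicit Defensive.

Import Order.TTheory GRing.Theory Num.Theory.
Import numFieldNormedType.Exports.

Local Open Scope classical_set_scope.
Local Open Scope ring_scope.
Local Open Scope complex_scope.

(** Every element of [B] is [c e + I f] with [c = C a] and [f = D a], so [B] is
    the l1-sum of the complex line and [A].  For unimodular [mu] and [u] and for
    [x] in the Choquet boundary, the real functional
    [a |-> Re (conj mu * c) + Re (conj u * f x)] has norm one; call the part of
    the unit sphere on which it equals 1 a face.  The surjective isometry
    [Delta] turns out to permute the faces and to carry the functional of each
    face to the functional of its image.  These functionals separate the points
    of [B], so the positively homogeneous extension of [Delta] is real linear
    ([extends_of_functionals]).

    Faces are permuted ([face_rel_exists]).  A point of the sphere at distance 2
    from every point of the opposite of a face lies in that face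
    ([face_of_far]), so membership in a face is a metric notion relative to the
    opposite face.  The images of the points of a face can therefore be averaged
    without leaving the sphere, and [choquet_norming] provides one point of the
    Choquet boundary at which all of them peak.  That lemma contains the fact
    that the Choquet boundary norms [A]; it is proved by a Krein-Milman argument
    on compact subsets of [X], with sublinear functionals given by maxima over
    these subsets in place of faces of the dual ball, so that neither weak-star
    compactness nor the Hahn-Banach theorem enters.

    How faces move.  Two faces over the same [x] with obtuse phases are at
    distance at least 1.4, whereas faces over distinct points come closer than
    that; hence the point [x'] of the image face depends on [x] alone
    ([same_x]).  Looking at the two faces [(mu, 1, x)] and [(mu, -1, x)] through
    [mu e], one finds that [Delta (mu e)] lies in [ker D] or in [ker C]
    ([axis_or]).  The second case forces the Choquet boundary to be a single
    point ([off_axis_singleton]); then [A] is a line, and composing [Delta] with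
    the exchange of the two summands leads back to the first case.

    In the first case [Delta] preserves [|C a|] and turns the phase of [C a] by
    an isometry of the circle ([cpart_d]).  For the other coordinate one compares
    [a] with [C a * e + I (r w h)], where [r] is the norm of [D a] and [h] peaks
    at [x]: the distance is at least [r + |D a x|] for all such [h] only if [w] is
    opposite to the phase of [D a x].  Matching this on both sides of [Delta] gives
    [|D (Delta a) x'| = |D a x|] and the correspondence of the phases
    ([dpart_phase], [dot_dpart]). *)

(** * Real-valued norms and the complex plane as a Euclidean plane *)

(** The norms of the statement take values in [R[i]]; the real version lets
    linear and nonlinear arithmetic over [R] apply.  It is locked, as are [cmod],
    [dot] and [ev] below, so that conversion never unfolds a norm down to a
    supremum or a square root. *)
HB.lock Definition rnorm (R : realType) (V : normedZmodType R[i]) (v : V) : R :=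
  complex.Re `|v|.

Section RealValuedNorm.
Variables (R : realType) (V : normedZmodType R[i]).
Implicit Types v w : V.

Lemma rnormE v : `|v| = (rnorm v)%:C.
Proof. by rewrite rnorm.unlock RRe_real// normr_real. Qed.

Lemma rnorm_ge0 v : 0 <= rnorm v.
Proof. by rewrite -ler0c -rnormE. Qed.

Lemma rnorm0 : rnorm (0 : V) = 0.
Proof. by rewrite rnorm.unlock normr0. Qed.

Lemma rnorm_eq0 v : rnorm v = 0 -> v = 0.
Proof. by move=> v0; apply/normr0_eq0; rewrite rnormE v0. Qed.

Lemma rnormN v : rnorm (- v) = rnorm v.
Proof. by rewrite rnorm.unlock normrN. Qed.

Lemma rnormB v w : rnorm (v - w) = rnorm (w - v).
Proof. by rewrite rnorm.unlock distrC. Qed.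

Lemma rnormD v w : rnorm (v + w) <= rnorm v + rnorm w.
Proof. by rewrite -lecR rmorphD/= -!rnormE ler_normD. Qed.

Lemma rnorm_gt0 v : v <> 0 -> 0 < rnorm v.
Proof. by move=> v0; rewrite lt_def rnorm_ge0 andbT; apply/eqP => /rnorm_eq0. Qed.

End RealValuedNorm.

(** The real norm on [R[i]] itself, kept apart from [rnorm] so that its terms do
    not depend on which normed structure was inferred for [R[i]]. *)
HB.lock Definition cmod (R : realType) (z : R[i]) : R := complex.Re `|z|.

(** The real part of [conj z * w]. *)
HB.lock Definition dot (R : realType) (z w : R[i]) : R :=
  complex.Re z * complex.Re w + complex.Im z * complex.Im w.

Section ComplexPlane.
Variable R : realType.
Implicit Types (z w u : R[i]) (r : R).

Let cmodr z : cmod z = rnorm z.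
Proof. by rewrite cmod.unlock rnorm.unlock. Qed.

Lemma cmodE z : `|z| = (cmod z)%:C.
Proof. by rewrite !cmodr; exact: (@rnormE R R[i] z). Qed.

Lemma cmod_ge0 z : 0 <= cmod z.
Proof. by rewrite !cmodr; exact: (@rnorm_ge0 R R[i] z). Qed.

Lemma cmod0 : cmod (0 : R[i]) = 0.
Proof. by rewrite !cmodr; exact: (@rnorm0 R R[i]). Qed.

Lemma cmod_eq0 z : cmod z = 0 -> z = 0.
Proof. by rewrite !cmodr; exact: (@rnorm_eq0 R R[i] z). Qed.

Lemma cmodN z : cmod (- z) = cmod z.
Proof. by rewrite !cmodr; exact: (@rnormN R R[i] z). Qed.

Lemma cmodB z w : cmod (z - w) = cmod (w - z).
Proof. by rewrite !cmodr; exact: (@rnormB R R[i] z w). Qed.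

Lemma cmodD z w : cmod (z + w) <= cmod z + cmod w.
Proof. by rewrite !cmodr; exact: (@rnormD R R[i] z w). Qed.

Lemma cmod_gt0 z : z <> 0 -> 0 < cmod z.
Proof. by rewrite !cmodr; exact: (@rnorm_gt0 R R[i] z). Qed.

Lemma cmodM z w : cmod (z * w) = cmod z * cmod w.
Proof. by apply/complexI; rewrite rmorphM/= -!cmodE normrM. Qed.

Lemma cmod_real r : cmod (r%:C) = `|r|.
Proof. by rewrite cmod.unlock normc_def/= expr0n addr0 sqrtr_sqr. Qed.

Lemma cmod1 : cmod (1 : R[i]) = 1.
Proof. by rewrite cmod.unlock normr1. Qed.

Lemma cmod_sqr z : cmod z ^+ 2 = dot z z.
Proof.
by rewrite cmod.unlock normc_def/= sqr_sqrtr ?addr_ge0 ?sqr_ge0// dot.unlock -!expr2.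
Qed.

Lemma dotC z w : dot z w = dot w z.
Proof. by rewrite dot.unlock [LHS]addrC [RHS]addrC; congr (_ + _); rewrite mulrC. Qed.

Lemma dotDr z w u : dot z (w + u) = dot z w + dot z u.
Proof. by case: z w u => [a b] [c d] [e f]; rewrite dot.unlock/=; ring. Qed.

Lemma dotNr z w : dot z (- w) = - dot z w.
Proof. by case: z w => [a b] [c d]; rewrite dot.unlock/=; ring. Qed.

Lemma dotZr z r w : dot z (r%:C * w) = r * dot z w.
Proof. by case: z w => [a b] [c d]; rewrite dot.unlock/=; ring. Qed.

Lemma dotDl z w u : dot (z + w) u = dot z u + dot w u.
Proof. by rewrite dotC dotDr !(dotC u). Qed.

Lemma dotNl z w : dot (- z) w = - dot z w.
Proof. by rewrite dotC dotNr dotC. Qed.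

Lemma dotZl z r w : dot (r%:C * z) w = r * dot z w.
Proof. by rewrite dotC dotZr dotC. Qed.

Lemma dot0r z : dot z 0 = 0.
Proof. by rewrite dot.unlock/= !mulr0 addr0. Qed.

Lemma cmodD_sqr z w :
  cmod (z + w) ^+ 2 = cmod z ^+ 2 + 2 * dot z w + cmod w ^+ 2.
Proof.
rewrite !cmod_sqr dotDl !dotDr (dotC w z); ring.
Qed.

Lemma dot_le z w : dot z w <= cmod z * cmod w.
Proof.
have h := cmodD z w; have hs := cmodD_sqr z w.
have := cmod_ge0 z; have := cmod_ge0 w; have := cmod_ge0 (z + w).
move: (cmod z) (cmod w) (cmod (z + w)) (dot z w) h hs => a b c d; nra.
Qed.

(** Equality in the Cauchy-Schwarz inequality. *)
Lemma dot_eq_cmod u z : cmod u = 1 -> cmod z <= dot u z ->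
  z = (cmod z)%:C * u.
Proof.
move=> u1 uz; apply/eqP; rewrite -subr_eq0; apply/eqP/cmod_eq0/eqP.
rewrite -sqrf_eq0; apply/eqP/le_anti; rewrite sqr_ge0 andbT.
rewrite cmodD_sqr cmodN cmodM cmod_real u1 dotNr dotZr (dotC z).
have := cmod_ge0 z => z0; rewrite ger0_norm//; nra.
Qed.

(** Equality in the triangle inequality, in the form used to read off phases. *)
Lemma cmodD_eq z w u : cmod u = 1 -> w = (cmod w)%:C * u -> 0 < cmod w ->
  cmod z + cmod w <= cmod (z + w) -> z = (cmod z)%:C * u.
Proof.
move=> u1 wE w0 h; apply: dot_eq_cmod => //.
have := cmodD_sqr z w; rewrite {2}wE dotZr (dotC z u).
have := cmod_ge0 z; have := cmod_ge0 (z + w).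
move: (cmod z) (cmod w) (cmod (z + w)) (dot u z) w0 h => a b c d; nra.
Qed.

Lemma polar z : exists2 u, cmod u = 1 & z = (cmod z)%:C * u.
Proof.
have [->|z0] := pselect (z = 0).
  by exists 1; rewrite ?cmod1// cmod0 mul0r.
have zp := cmod_gt0 z0.
exists ((cmod z)^-1%:C * z); last by rewrite mulrA -rmorphM mulfV ?mul1r// gt_eqF.
by rewrite cmodM cmod_real ger0_norm ?invr_ge0 ?cmod_ge0// mulVf// gt_eqF.
Qed.

Lemma cmod_scaled (r : R) u : 0 <= r -> cmod u = 1 -> cmod (r%:C * u) = r.
Proof. by move=> r0 u1; rewrite cmodM u1 mulr1 cmod_real ger0_norm. Qed.

Lemma scaled_inj (r : R) u w : 0 < r -> r%:C * u = r%:C * w -> u = w.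
Proof.
by move=> r0; apply: mulfI; apply/eqP => /complexI rE; rewrite rE ltxx in r0.
Qed.

Lemma dot_neq0 z : (forall u, cmod u = 1 -> dot u z = 0) -> z = 0.
Proof.
move=> h; have [u u1 zE] := polar z.
have := h u u1; rewrite {1}zE dotZr -cmod_sqr u1 expr1n mulr1 => z0.
exact: cmod_eq0.
Qed.

End ComplexPlane.

Lemma rnormZ (R : realType) (V : normedModType R[i]) (c : R[i]) (v : V) :
  rnorm (c *: v) = cmod c * rnorm v.
Proof. by apply/complexI; rewrite rmorphM/= -cmodE -!rnormE normrZ. Qed.

(** Arithmetic over [R] in which norms and inner products are generalized to real
    variables beforehand: comparing them up to conversion would be costly. *)
Ltac abstract_norms :=
  repeat match goal with
  | |- context [@rnorm ?R ?V ?v] =>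
      let r := fresh "r" in set (r := @rnorm R V v) in *; clearbody r
  | |- context [@dot ?R ?z ?w] =>
      let r := fresh "r" in set (r := @dot R z w) in *; clearbody r
  | |- context [@cmod ?R ?v] =>
      let r := fresh "r" in set (r := @cmod R v) in *; clearbody r
  | H : context [@cmod ?R ?v] |- _ =>
      let r := fresh "r" in set (r := @cmod R v) in *; clearbody r
  | H : context [@rnorm ?R ?V ?v] |- _ =>
      let r := fresh "r" in set (r := @rnorm R V v) in *; clearbody r
  | H : context [@dot ?R ?z ?w] |- _ =>
      let r := fresh "r" in set (r := @dot R z w) in *; clearbody r
  end.
Ltac is_clutter P :=
  lazymatch P with
  | is_true (@Order.le _ _ _ _) => fail
  | is_true (@Order.lt _ _ _ _) => fail
  | @eq ?T _ _ => match goal with R : realType |- _ =>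
      tryif unify T (Real.sort R) then fail else idtac end
  | _ => lazymatch type of P with Prop => idtac | _ => fail end
  end.
Ltac norm_prepare :=
  intros; abstract_norms;
  repeat match goal with H : ?P |- _ => is_clutter P; clear H end.
Ltac norm_lra := norm_prepare; lra.
Ltac norm_nra := norm_prepare; nra.

(** * Evaluation of functions, and compactness *)

Lemma directed_compact (X : topologicalType) (I : Type) (D : set I)
    (G : I -> set X) (K : set X) :
  compact K -> D !=set0 -> (forall i, D i -> closed (G i)) ->
  (forall i, D i -> G i `<=` K) -> (forall i, D i -> G i !=set0) ->
  (forall i j, D i -> D j -> exists2 k, D k & G k `<=` G i `&` G j) ->
  exists x, forall i, D i -> G i x.
Proof.
move=> Kc [i0 Di0] Gc GK G0 Gd.
have FF : Filter (filter_from D G) by apply: filter_from_filter => //; exists i0.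
have PF : ProperFilter (filter_from D G) by apply: filter_from_proper.
have [|x [_ xG]] := Kc _ PF; first by exists i0 => //; exact: GK.
exists x => i Di; apply: (Gc i Di) => U Ux.
by apply: xG => //; exists i.
Qed.

HB.lock Definition ev (R : realType) (X : topologicalType)
  (A : submodClosed (C0 R X)) (f : subspace_of A) (x : X) : R[i] := val f x.

Section Evaluation.
Variables (R : realType) (X : topologicalType) (A : submodClosed (C0 R X)).
Local Notation A_ := (subspace_of A).
Implicit Types (f g : A_) (x : X).

Lemma evE f x : ev f x = val f x.
Proof. by rewrite ev.unlock. Qed.

Lemma evD f g x : ev (f + g) x = ev f x + ev g x.
Proof. by rewrite ev.unlock raddfD. Qed.

Lemma evN f x : ev (- f) x = - ev f x.
Proof. by rewrite ev.unlock raddfN. Qed.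

Lemma evB f g x : ev (f - g) x = ev f x - ev g x.
Proof. by rewrite evD evN. Qed.

Lemma ev0 x : ev (0 : A_) x = 0.
Proof. by rewrite ev.unlock raddf0. Qed.

Lemma evZ (c : R[i]) f x : ev (c *: f) x = c * ev f x.
Proof. by rewrite ev.unlock (linearZ_LR (val : A_ -> C0 R X)). Qed.

(* General facts about [rnorm], restated for [A]: applying the general lemma in
   place leaves operations of a different, only convertible, structure. *)
Lemma rnormZ_ev (c : R[i]) f : rnorm (c *: f) = cmod c * rnorm f.
Proof. exact: rnormZ. Qed.

Lemma rnormD_ev f g : rnorm (f + g) <= rnorm f + rnorm g.
Proof. exact: rnormD. Qed.

Lemma rnorm_ev_le f x : cmod (ev f x) <= rnorm f.
Proof. by rewrite -lecR -cmodE -rnormE ev.unlock; exact: C0_le_norm. Qed.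

Lemma rnorm_le f (M : R) :
  0 <= M -> (forall x, cmod (ev f x) <= M) -> rnorm f <= M.
Proof.
move=> M0 fM; rewrite -lecR -rnormE subspace_normE C0_normE.
by apply: sup_norm_le => [|x _]; rewrite ?ler0c// -evE cmodE lecR fM.
Qed.

Lemma rnorm_ev_continuous f : continuous (fun x => cmod (ev f x) : R).
Proof.
have /asboolP[fc _] := valP (val f).
by under eq_fun do rewrite cmod.unlock ev.unlock; exact: (Re_norm_continuous fc).
Qed.

Lemma dot_ev_continuous f g :
  continuous (fun x => dot (ev f x) (ev g x) : R).
Proof.
have sqc (h : A_) : continuous (fun x => cmod (ev h x) ^+ 2 : R).
  move=> x; apply: (@continuous_comp _ _ _ (fun x => cmod (ev h x) : R)
    (fun y : R => y ^+ 2)); first exact: rnorm_ev_continuous.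
  exact: exprn_continuous.
(* polarization reduces the claim to continuity of the modulus *)
have -> : (fun x => dot (ev f x) (ev g x) : R) = (fun x =>
   2^-1 * (cmod (ev (f + g) x) ^+ 2 - cmod (ev f x) ^+ 2
     - cmod (ev g x) ^+ 2) : R).
  by apply/funext => x; rewrite evD cmodD_sqr; field.
move=> x; apply: cvgM; first exact: cvg_cst.
by apply: (@cvgB R R^o); [apply: (@cvgB R R^o)|]; exact: sqc.
Qed.

Lemma closed_ge_fun (h : X -> R) (M : R) :
  continuous h -> closed [set x | M <= h x].
Proof.
move=> hc; rewrite (_ : mkset _ = h @^-1` [set y | M <= y])//.
by apply: preimage_closed; [move=> x _; exact: hc|exact: closed_ge].
Qed.

Lemma closed_le_fun (h : X -> R) (M : R) :
  continuous h -> closed [set x | h x <= M].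
Proof.
move=> hc; rewrite (_ : mkset _ = h @^-1` [set y | y <= M])//.
by apply: preimage_closed; [move=> x _; exact: hc|exact: closed_le].
Qed.

Lemma compact_ge_ev f (e : R) : 0 < e -> compact [set x | e <= cmod (ev f x)].
Proof.
move=> e0; have /asboolP[_ /(_ e e0)] := valP (val f).
congr (compact _); apply/seteqP; split=> x /=;
  by rewrite -evE cmodE lecR.
Qed.

(** The functions vanish at infinity, so only the compact set where the modulus
    is at least half the norm matters. *)
Lemma rnorm_attained f : f <> 0 -> exists x, cmod (ev f x) = rnorm f.
Proof.
move=> f0; have fp := rnorm_gt0 f0.
pose K := [set x | rnorm f / 2 <= cmod (ev f x)].
have K0 : K !=set0.
  apply: contrapT => h; have : rnorm f <= rnorm f / 2.
    apply: rnorm_le => [|x]; first by rewrite divr_ge0// ltW.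
    by rewrite leNgt; apply/negP => hx; apply: h; exists x; rewrite /K/= ltW.
  norm_lra.
have [|c /set_mem Kc cmax] := @compact_EVT_max X R (fun x => cmod (ev f x))
  K K0 (compact_ge_ev (divr_gt0 fp (ltr0n R 2))).
  by apply: continuous_subspaceT; exact: rnorm_ev_continuous.
exists c; apply/eqP; rewrite eq_le rnorm_ev_le/=.
apply: rnorm_le => [|x]; first exact: cmod_ge0.
have [xK|xK] := leP (rnorm f / 2) (cmod (ev f x)); first exact: cmax (mem_set xK).
by rewrite (le_trans (ltW xK)).
Qed.

End Evaluation.

(** * The Choquet boundary norms families with additive norm *)

Lemma archi_ge (R : realType) (d C : R) (n0 : nat) :
  0 < d -> exists2 n, (n0 <= n)%N & C <= n%:R * d.
Proof.
move=> d0; exists (n0 + (Num.truncn (C / d)).+1)%N; first exact: leq_addr.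
have := truncnS_gt (C / d); rewrite ltr_pdivrMr// => /ltW h.
by rewrite (le_trans h)// ler_pM2r// ler_nat leq_addl.
Qed.

Section Carried.
Variables (R : realType) (X : topologicalType) (A : submodClosed (C0 R X)).
Local Notation A_ := (subspace_of A).
Implicit Types (f g h w : A_) (x : X) (K : set X) (l : A_ -> R).

(** Real parts of elements of the dual ball: additivity and the bound together
    force real linearity. *)
Definition contractive l :=
  (forall g h, l (g + h) = l g + l h) /\ (forall g, l g <= rnorm g).

(** [l] is dominated by the sublinear functional
    [g |-> max over K of Re (conj (w x) * g x)].  For contractive [l]
    and compact [K] this means that [l] belongs to the weak-star closed convex hull of the functionals
    [g |-> Re (conj (w x) * g x)], [x] in [K]; quantifying over the bound [M]
    avoids naming the maximum. *)
Definition carried w K l := forall g (M : R),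
  (forall x, K x -> dot (ev w x) (ev g x) <= M) -> l g <= M.

(** The convex set of functionals carried by [K] is a face of the dual ball.  One
    component is enough, by the symmetry [extremal_right]. *)
Definition extremal w K := forall l1 l2 (t : R),
  contractive l1 -> contractive l2 -> 0 < t -> t < 1 ->
  carried w K (fun g => t * l1 g + (1 - t) * l2 g) -> carried w K l1.

Lemma extremal_right w K l1 l2 (t : R) : extremal w K ->
  contractive l1 -> contractive l2 -> 0 < t -> t < 1 ->
  carried w K (fun g => t * l1 g + (1 - t) * l2 g) -> carried w K l2.
Proof.
move=> Ke l1c l2c t0 t1 lK; apply: (Ke l2 l1 (1 - t)) => //.
- by rewrite subr_gt0.
- by rewrite gtrBl.
- by under eq_fun do rewrite subKr addrC.
Qed.

Lemma contractive0 l : contractive l -> l 0 = 0.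
Proof. by move=> [lD _]; have := lD 0 0; rewrite addr0; norm_lra. Qed.

Lemma contractiveN l g : contractive l -> l (- g) = - l g.
Proof.
move=> lc; have := contractive0 lc; rewrite -{1}(subrr g) lc.1; norm_lra.
Qed.

Lemma contractiveMn l g n : contractive l -> l (g *+ n) = n%:R * l g.
Proof.
move=> lc; elim: n => [|n IH]; first by rewrite mulr0n mul0r contractive0.
by rewrite mulrS lc.1 IH -addn1 natrD mulrDl mul1r addrC.
Qed.

Lemma evMn f n x : ev (f *+ n) x = n%:R%:C * ev f x.
Proof.
elim: n => [|n IH]; first by rewrite mulr0n ev0 mul0r.
by rewrite mulrS evD IH -addn1 natrD rmorphD/= mulrDl mul1r addrC.
Qed.

Lemma carriedS w K K' l : K `<=` K' -> carried w K l -> carried w K' l.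
Proof. by move=> KK' lK g M gM; apply: lK => x /KK'; exact: gM. Qed.

(** A functional of norm one which attains its norm at [f] is carried by the set
    where [|f|] is maximal.  Indeed [l g = l (g + n f) - n |f|] is at most
    [|g + n f| - n |f|], and these bounds decrease to the maximum over that set
    of [Re (conj (f x) * g x) / |f|], the derivative of the modulus. *)
Lemma contractive_peak l f g (M : R) : contractive l -> f <> 0 ->
  l f = rnorm f ->
  (forall x, cmod (ev f x) = rnorm f ->
     dot (ev f x) (ev g x) <= rnorm f * M) ->
  l g <= M.
Proof.
move=> lc f0 lf fgM; have N0 := rnorm_gt0 f0; set N := rnorm f in lf fgM N0.
apply/ler_addgt0Pr => e e0; rewrite leNgt; apply/negP => lg.
have [n0 _ hn0] := archi_ge (- (M + e)) 0 N0.
pose E n := [set x | M + e + n%:R * N <= cmod (ev (g + f *+ n) x)].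
have Emono m n : (m <= n)%N -> E n `<=` E m.
  move=> mn x; rewrite /E /= => h.
  have gE : cmod (ev (g + f *+ n) x) <=
      cmod (ev (g + f *+ m) x) + (n%:R - m%:R) * cmod (ev f x).
    rewrite -natrB// -[n in f *+ n](subnKC mn) mulrnDr addrA (evD (g + f *+ m)).
    apply: le_trans (cmodD _ _) _; rewrite lerD2l evMn cmodM cmod_real.
    by rewrite ger0_norm.
  have mn' : 0 <= n%:R - m%:R :> R by rewrite subr_ge0 ler_nat.
  have := ler_wpM2l mn' (rnorm_ev_le f x); rewrite -/N; norm_lra.
have Ec n : closed (E n).
  by apply: closed_ge_fun; exact: rnorm_ev_continuous.
have [||||||x hx] := @directed_compact X nat [set n | (n0.+1 <= n)%N] E (E n0.+1).
- apply: compact_ge_ev; rewrite -natr1 mulrDl; norm_lra.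
- by exists n0.+1 => /=.
- by move=> n _; exact: Ec.
- by move=> n; exact: Emono.
- move=> n /= n0n; apply: contrapT => En.
  suff : rnorm (g + f *+ n) <= M + e + n%:R * N.
    have := lc.2 (g + f *+ n); rewrite lc.1 contractiveMn// lf; norm_lra.
  have n0n' : n0%:R <= n%:R :> R by rewrite ler_nat ltnW.
  apply: rnorm_le => [|x].
    have := ler_wpM2r (ltW N0) n0n'; norm_lra.
  by rewrite leNgt; apply/negP => hx; apply: En; exists x; rewrite /E/= ltW.
- move=> m n /= hm hn; exists (maxn m n); first by rewrite leq_max hm.
  by move=> x Ex; split; apply: Emono Ex; rewrite ?leq_maxl ?leq_maxr.
have Ex n : (n0.+1 <= n)%N ->
    M + e + n%:R * N <= cmod (ev g x + n%:R%:C * ev f x).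
  by move=> /hx; rewrite /E/= evD evMn.
(* a point common to all the sets [E n] maximizes [|f|] and violates [fgM] *)
have fx : cmod (ev f x) = N.
  apply/eqP; rewrite eq_le rnorm_ev_le/= leNgt; apply/negP => fx.
  have d0 : 0 < N - cmod (ev f x) by rewrite subr_gt0.
  have [n n0n] := archi_ge (cmod (ev g x) - M) n0.+1 d0.
  have := cmodD (ev g x) (n%:R%:C * ev f x).
  rewrite cmodM cmod_real ger0_norm//; have := Ex _ n0n; norm_lra.
have Ne : 0 < 2 * N * e by rewrite !mulr_gt0.
have [n n0n hn] := archi_ge (cmod (ev g x) ^+ 2 + 1) n0.+1 Ne.
have rE := cmodD_sqr (ev g x) (n%:R%:C * ev f x).
move: rE; rewrite cmodM cmod_real ger0_norm// fx dotZr (dotC (ev g x)) => rE.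
have n0n' : n0%:R <= n%:R :> R by rewrite ler_nat ltnW.
have k1 := ler_wpM2r (ltW N0) n0n'.
have k2 : n%:R * dot (ev f x) (ev g x) <= n%:R * (N * M).
  by apply: ler_wpM2l => //; exact: fgM.
have k3 : (M + e + n%:R * N) ^+ 2 <= cmod (ev g x + n%:R%:C * ev f x) ^+ 2.
  rewrite ler_pXn2r// ?nnegrE ?cmod_ge0//; first exact: Ex.
  norm_lra.
have := sqr_ge0 (M + e); move: k3; rewrite rE => k3.
have -> : (M + e) ^+ 2 = (M + e + n%:R * N) ^+ 2
  - (n%:R * N) ^+ 2 - 2 * (n%:R * (N * M)) - n%:R * (2 * N * e) by ring.
norm_lra.
Qed.

Lemma carried_bigcap (I : Type) (D : set I) (G : I -> set X) K w l :
  compact K -> D !=set0 -> (forall i, D i -> closed (G i)) ->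
  (forall i, D i -> G i `<=` K) ->
  (forall i j, D i -> D j -> exists2 k, D k & G k `<=` G i `&` G j) ->
  (forall i, D i -> carried w (G i) l) ->
  carried w [set x | forall i, D i -> G i x] l.
Proof.
move=> Kc D0 Gc GK Gd lG g M gM; apply/ler_addgt0Pr => e e0.
rewrite leNgt; apply/negP => lg.
pose E i := G i `&` [set x | M + e <= dot (ev w x) (ev g x)].
have [||||||x hx] := @directed_compact X I D E K => //.
- move=> i Di; apply: closedI; first exact: Gc.
  by apply: closed_ge_fun; exact: dot_ev_continuous.
- by move=> i Di x [/GK Kx _]; exact: Kx.
- move=> i Di; apply: contrapT => Ei; move: lg; rewrite ltNge => /negP; apply.
  apply: (lG i Di) => x Gx; rewrite leNgt; apply/negP => hx.
  by apply: Ei; exists x; split=> //=; exact: ltW.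
- move=> i j Di Dj; have [k Dk Gk] := Gd i j Di Dj; exists k => // x [Gx hx].
  by have [] := Gk _ Gx.
have [i Di] := D0; have [_ /=] := hx i Di.
have := gM x (fun i Di => (hx i Di).1); norm_lra.
Qed.

(** The same derivative argument inside [K]: if [l] attains the maximum of [g] over
    [K], then it is carried by the points where that maximum is reached, since
    [l h = l (h + n g) - n M] for all [n]. *)
Lemma carried_max K w l g (M : R) :
  compact K -> closed K -> contractive l -> carried w K l ->
  (forall x, K x -> dot (ev w x) (ev g x) <= M) -> l g = M ->
  carried w (K `&` [set x | dot (ev w x) (ev g x) = M]) l.
Proof.
move=> Kc Kcl lc lK gM lg h L hL; apply/ler_addgt0Pr => e e0.
rewrite leNgt; apply/negP => lh.
pose E n := K `&` [set x | L + e + n%:R * M <= dot (ev w x) (ev (h + g *+ n) x)].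
have [||||||x hx] := @directed_compact X nat setT E K => //.
- move=> n _; apply: closedI => //.
  by apply: closed_ge_fun; exact: dot_ev_continuous.
- by move=> n _ x [].
- move=> n _; apply: contrapT => En.
  suff : l (h + g *+ n) <= L + e + n%:R * M.
    rewrite lc.1 contractiveMn// lg; norm_lra.
  apply: lK => x Kx; rewrite leNgt; apply/negP => hx.
  by apply: En; exists x; split=> //=; exact: ltW.
- move=> m n _ _; exists (maxn m n) => //.
  have mono i j : (i <= j)%N -> E j `<=` E i.
    move=> ij x [Kx] /=; rewrite !evD !evMn !dotDr !dotZr => hx; split=> //=.
    rewrite !evD !evMn !dotDr !dotZr.
    have ij' : 0 <= j%:R - i%:R :> R by rewrite subr_ge0 ler_nat.
    have := ler_wpM2l ij' (gM x Kx); norm_lra.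
  by move=> x Ex; split; apply: mono Ex; rewrite ?leq_maxl ?leq_maxr.
have [Kx _] := hx 0%N I.
have Ex n : L + e + n%:R * M <= dot (ev w x) (ev h x) + n%:R * dot (ev w x) (ev g x).
  by have [_ /=] := hx n I; rewrite evD evMn dotDr dotZr.
have gx : dot (ev w x) (ev g x) = M.
  apply/eqP; rewrite eq_le gM//= leNgt; apply/negP => gx.
  have d0 : 0 < M - dot (ev w x) (ev g x) by rewrite subr_gt0.
  have [n _] := archi_ge (dot (ev w x) (ev h x) - L) 0 d0.
  have := Ex n; norm_lra.
have := Ex 0%N; have := hL x (conj Kx gx); norm_lra.
Qed.

(** If an average of two functionals attains the maximum of [g] over [K], each of
    them does; so maximizing any [g] refines an extremal set. *)
Lemma extremal_max K w g (M : R) : compact K -> closed K -> extremal w K ->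
  (forall x, K x -> dot (ev w x) (ev g x) <= M) ->
  extremal w (K `&` [set x | dot (ev w x) (ev g x) = M]).
Proof.
move=> Kc Kcl Ke gM l1 l2 t l1c l2c t0 t1 lK'.
have lK := carriedS (@subIsetl _ K _) lK'.
have l1K := Ke _ _ _ l1c l2c t0 t1 lK.
have l2K := extremal_right Ke l1c l2c t0 t1 lK.
apply: carried_max => //.
have l1g := l1K g M gM; have l2g := l2K g M gM.
have /= := lK' (- g) (- M); rewrite !contractiveN// => lg.
have {}lg : t * - l1 g + (1 - t) * - l2 g <= - M.
  by apply: lg => x [_ /= <-]; rewrite evN dotNr.
apply/eqP; rewrite eq_le l1g/=; norm_nra.
Qed.

(** When no [g] separates the points of the extremal set [K], being carried by [K]
    amounts to being equal to the functional of [x], and extremality of [K] says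
    that this functional is an extreme point. *)
Lemma choquet_of_separated w K x : K x -> cmod (ev w x) = 1 ->
  extremal w K ->
  (forall g y, K y -> dot (ev w y) (ev g y) = dot (ev w x) (ev g x)) ->
  choquet_boundary A x.
Proof.
move=> Kx wx Ke Kg.
have contr_dual (y : dual A_) : closed_unit_ball (dual A_) y ->
    contractive (fun g => dot (ev w x) (y g)).
  have /asboolP[yl _] := valP y.
  move=> y1; split=> [g h|g].
    by rewrite -dotDr; have := yl 1 g h; rewrite !scale1r => ->.
  apply: le_trans (dot_le _ _) _; rewrite wx mul1r -lecR -cmodE -rnormE.
  by apply: le_trans (dual_le_norm y g) _; rewrite ler_piMl.
have eq_dual (y : dual A_) :
    carried w K (fun g => dot (ev w x) (y g)) -> y = delta A x.
  have /asboolP[yl _] := valP y.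
  move=> yK; apply/val_inj/funext => g /=; rewrite -evE.
  apply/eqP; rewrite -subr_eq0; apply/eqP.
  have [//|z0] := pselect (y g - ev g x = 0).
  have le1 h : dot (ev w x) (y h) <= dot (ev w x) (ev h x).
    by apply: yK => z Kz; rewrite Kg.
  have yZ (c : R[i]) h : y (c *: h) = c * y h.
    have yl' (d : R[i]) f f' : y (d *: f + f') = d * y f + y f' := yl d f f'.
    have y0 : y 0 = 0.
      have /esym/eqP := yl' 1 0 0; rewrite scale1r mul1r addr0.
      by rewrite -subr_eq0 addrK => /eqP.
    by have := yl' c h 0; rewrite addr0 y0 addr0.
  have z1 : (y g - ev g x) != 0 by apply/eqP.
  (* a multiple of [g] on which the inequality would fail by one *)
  have := le1 ((ev w x / (y g - ev g x)) *: g).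
  rewrite yZ evZ -subr_ge0 -dotNr -dotDr -mulrBr -(opprB (y g)) mulrN.
  by rewrite divfK// dotNr -cmod_sqr wx expr1n oppr_ge0 ler10.
split.
  rewrite /closed_unit_ball/= dual_normE; apply: sup_norm_le => // f f1.
  by apply: le_trans f1; exact: C0_le_norm.
move=> y z t y1 z1 t0 t1 dE.
have tR : t = (complex.Re t)%:C by rewrite RRe_real// ger0_real// ltW.
move: t0 t1; rewrite tR => t0 t1.
have {}t0 : 0 < complex.Re t by rewrite -ltcR.
have {}t1 : complex.Re t < 1 by rewrite -ltcR.
have dE' g : ev g x = (complex.Re t)%:C * y g + (1 - complex.Re t)%:C * z g.
  rewrite rmorphB/= -tR; have := congr1 (fun p : dual A_ => p g) dE.
  by rewrite evE.
have avg : carried w K (fun g => complex.Re t * dot (ev w x) (y g) +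
    (1 - complex.Re t) * dot (ev w x) (z g)).
  by move=> g M gM /=; rewrite -!dotZr -dotDr -dE'; exact: gM.
split; apply: eq_dual.
- exact: Ke (contr_dual _ y1) (contr_dual _ z1) t0 t1 avg.
- exact: extremal_right Ke (contr_dual _ y1) (contr_dual _ z1) t0 t1 avg.
Qed.

(** A minimal extremal set exists by compactness, and [extremal_max] shows that no
    function separates its points.  Zorn's lemma is stated for unions, so it is
    applied to the complements [O] of the candidates. *)
Lemma extremal_choquet w K : compact K -> closed K -> K !=set0 ->
  (forall x, K x -> cmod (ev w x) = 1) -> extremal w K ->
  exists2 x, K x & choquet_boundary A x.
Proof.
move=> Kc Kcl K0 Kw Ke.
pose P (O : set X) := [/\ closed (K `\` O), K `\` O !=set0 & extremal w (K `\` O)].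
have [F FP Ft|O [[Ocl O0 Oe] Omax]] := @Zorn_bigcup X P.
  have [->|/set0P[V0 FV0]] := eqVneq F set0.
    by rewrite bigcup_set0 /P setD0.
  have KE : K `\` \bigcup_(O in F) O = [set x | forall O, F O -> (K `\` O) x].
    apply/seteqP; split=> [x [Kx nx] O FO|x h].
      by split=> // Ox; apply: nx; exists O.
    by split=> [|[U FU Ux]]; [have [] := h _ FV0|have [_ []] := h _ FU].
  have Fd O O' : F O -> F O' ->
      exists2 O2, F O2 & K `\` O2 `<=` (K `\` O) `&` (K `\` O').
    move=> FO FO'; have [OO'|O'O] := Ft O O' FO FO'.
      by exists O' => // x [Kx nx]; split; split=> // /OO'.
    by exists O => // x [Kx nx]; split; split=> // /O'O.
  rewrite /P KE; split.
  - have -> : [set x | forall O, F O -> (K `\` O) x] =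
        \bigcap_(O in F) (K `\` O) by [].
    by apply: closed_bigI => O /FP[].
  - have [||||||x hx] := @directed_compact X _ F (fun O => K `\` O) K => //.
    + by exists V0.
    + by move=> O /FP[].
    + by move=> O /FP[_ KO0 _]; exact: KO0.
    + by exists x.
  - move=> l1 l2 t l1c l2c t0 t1 lK.
    apply: (@carried_bigcap _ F (fun O => K `\` O) K) => //.
    + by exists V0.
    + by move=> O /FP[].
    + move=> O FO; have [_ _ Oe] := FP _ FO.
      by apply: (Oe l1 l2 t) => //; apply: carriedS lK => x /(_ O FO).
have [x KOx] := O0.
have KOc : compact (K `\` O) by apply: subclosed_compact Ocl Kc _ => y [].
exists x; first by have [] := KOx.
apply: (choquet_of_separated KOx (Kw x KOx.1) Oe) => g.
have gc : {within K `\` O, continuous (fun x => dot (ev w x) (ev g x) : R)}.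
  by apply: continuous_subspaceT; exact: dot_ev_continuous.
have [c /set_mem Kc' cmax] := compact_EVT_max O0 KOc gc.
have {}cmax y : (K `\` O) y -> dot (ev w y) (ev g y) <= dot (ev w c) (ev g c).
  by move=> /mem_set; exact: cmax.
suff gE y : (K `\` O) y -> dot (ev w y) (ev g y) = dot (ev w c) (ev g c).
  by move=> y KOy; rewrite !gE.
move=> KOy; apply: contrapT => yc.
pose K' := (K `\` O) `&` [set x | dot (ev w x) (ev g x) = dot (ev w c) (ev g c)].
have K'E : K `\` (~` K') = K'.
  by apply/seteqP; split=> z; [move=> [_ /contrapT]|move=> K'z; split; [case: K'z => -[]|]].
apply: (Omax (~` K')); last first.
  rewrite /P K'E; split; last exact: extremal_max.
    apply: closedI => //; have -> : [set x | dot (ev w x) (ev g x) = dot (ev w c) (ev g c)] =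
        [set x | dot (ev w x) (ev g x) <= dot (ev w c) (ev g c)] `&`
        [set x | dot (ev w c) (ev g c) <= dot (ev w x) (ev g x)].
      apply/seteqP; split=> z /= => [->|[zc cz]]; first by split.
      by apply/le_anti/andP.
    by apply: closedI; [apply: closed_le_fun|apply: closed_ge_fun];
      exact: dot_ev_continuous.
  by exists c.
split; first by move=> z Oz [[_ nOz] _]; exact: nOz.
by move=> /(_ y) h; have [_ nOy] := KOy; apply: nOy; apply: h => -[_].
Qed.

(** Since the norm is additive on [Q], each finite subfamily peaks at a common
    point with a common phase, and by compactness so does [Q].  The set of common
    peak points is extremal because a functional average attaining the norm of a
    member of [Q] forces both components to attain it; so this set meets the
    Choquet boundary. *)
Lemma choquet_norming (Q : set A_) f : Q f -> f <> 0 ->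
  (forall g h, Q g -> Q h -> Q (g + h)) ->
  (forall g h, Q g -> Q h -> rnorm (g + h) = rnorm g + rnorm h) ->
  exists x u, [/\ choquet_boundary A x, cmod u = 1 &
    forall g, Q g -> ev g x = (rnorm g)%:C * u].
Proof.
move=> Qf f0 QD Qn; have fp := rnorm_gt0 f0.
pose w := (rnorm f)^-1%:C *: f.
(* adding [f] keeps [G g] compact when [g = 0], and fixes the phase [w] *)
pose G g := [set x | rnorm (f + g) <= cmod (ev (f + g) x)].
have GE g x : Q g -> G g x ->
    cmod (ev w x) = 1 /\ ev g x = (rnorm g)%:C * ev w x.
  move=> Qg; rewrite /G/= evD Qn// => h.
  have := cmodD (ev f x) (ev g x).
  have fx := rnorm_ev_le f x; have gx := rnorm_ev_le g x => hh.
  have fxE : cmod (ev f x) = rnorm f by apply/eqP; rewrite eq_le fx/=; norm_lra.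
  have gxE : cmod (ev g x) = rnorm g by apply/eqP; rewrite eq_le gx/=; norm_lra.
  have w1 : cmod (ev w x) = 1.
    rewrite evZ cmodM cmod_real ger0_norm ?invr_ge0 ?rnorm_ge0//.
    by rewrite fxE mulVf// gt_eqF.
  split => //; rewrite -gxE; apply: (@cmodD_eq R _ (ev f x)) => //.
  - rewrite fxE evZ mulrA -rmorphM mulfV ?mul1r// gt_eqF//.
  - by rewrite fxE.
  - by rewrite fxE gxE addrC (addrC (ev g x)).
have Gc g : Q g -> compact (G g).
  move=> Qg; apply: compact_ge_ev; rewrite Qn//.
  by have := rnorm_ge0 g; norm_lra.
have Gcl g : closed (G g).
  by apply: closed_ge_fun; exact: rnorm_ev_continuous.
pose K0 := [set x | rnorm f <= cmod (ev f x)].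
have GK0 g : Q g -> G g `<=` K0.
  move=> Qg x; rewrite /G/K0/= evD Qn// => h.
  have := cmodD (ev f x) (ev g x); have := rnorm_ev_le g x; norm_lra.
have Gd g h : Q g -> Q h -> exists2 k, Q k & G k `<=` G g `&` G h.
  move=> Qg Qh; exists (g + h); first exact: QD.
  have main g' h' : Q g' -> Q h' -> G (g' + h') `<=` G g'.
    move=> Qg' Qh' x; rewrite /G/= addrA (evD (f + g')) (Qn (f + g'))//; last exact: QD.
    move=> h2; rewrite -(lerD2r (rnorm h')) (le_trans h2)//.
    by rewrite (le_trans (cmodD _ _))// lerD2l rnorm_ev_le.
  move=> x Gx; split; first exact: (main g h Qg Qh x Gx).
  by apply: (main h g Qh Qg x); rewrite addrC; exact: Gx.
pose K := [set x | forall g, Q g -> G g x].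
have KK0 : K `<=` K0 by move=> x /(_ f Qf); exact: GK0.
have K0c : compact K0 by exact: compact_ge_ev.
have Q0 : Q !=set0 by exists f.
have Kcl : closed K.
  have -> : K = \bigcap_(g in Q) G g by [].
  by apply: closed_bigI => g _; exact: Gcl.
have G0 g : Q g -> G g !=set0.
  move=> Qg; have [|x xE] := @rnorm_attained _ _ _ (f + g).
    move=> fg0; have := Qn f g Qf Qg; rewrite fg0 rnorm0.
    by have := rnorm_ge0 g; norm_lra.
  by exists x; rewrite /G/= xE.
have [] := @extremal_choquet w K.
- exact: subclosed_compact Kcl K0c KK0.
- exact: Kcl.
- have [x xK] := directed_compact K0c Q0 (fun g _ => Gcl g) GK0 G0 Gd.
  by exists x.
- by move=> x /(_ f Qf) /(GE _ _ Qf)[].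
- move=> l1 l2 t l1c l2c t0 t1 lK.
  apply: (carried_bigcap K0c Q0 (fun g _ => Gcl g) GK0 Gd) => g Qg h M hM.
  have fgE x : G g x -> ev (f + g) x = (rnorm (f + g))%:C * ev w x.
    move=> Gx; have [w1 gx] := GE _ _ Qg Gx.
    rewrite evD gx Qn// rmorphD mulrDl/=; congr (_ + _).
    by rewrite evZ mulrA -rmorphM mulfV ?mul1r// gt_eqF.
  have fg0 : f + g <> 0.
    move=> fg0; have := Qn f g Qf Qg; rewrite fg0 rnorm0.
    by have := rnorm_ge0 g; norm_lra.
  apply: (@contractive_peak l1 (f + g) h M) => //.
    have l1fg := l1c.2 (f + g); have l2fg := l2c.2 (f + g).
    have := lK (- (f + g)) (- rnorm (f + g)); rewrite /= !contractiveN// => lg.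
    have {}lg : t * - l1 (f + g) + (1 - t) * - l2 (f + g) <= - rnorm (f + g).
      apply: lg => x Kx; rewrite evN fgE; last exact: Kx.
      rewrite dotNr dotZr -cmod_sqr; have [-> _] := GE _ _ Qf (Kx _ Qf).
      by rewrite expr1n mulr1.
    apply/eqP; rewrite eq_le l1fg/=; norm_nra.
  move=> x xE; have Gx : G g x by rewrite /G/= xE.
  rewrite fgE// dotZl ler_wpM2l ?rnorm_ge0//; exact: hM.
move=> x Kx xch; exists x, (ev w x); split => //.
  exact: (GE _ _ Qf (Kx _ Qf)).1.
by move=> g Qg; exact: (GE _ _ Qg (Kx _ Qg)).2.
Qed.

End Carried.

Section Peaks.
Variables (R : realType) (X : topologicalType) (A : submodClosed (C0 R X)).
Hypothesis A_regular : extremely_C_regular A.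
Local Notation A_ := (subspace_of A).
Implicit Types (f g h : A_) (x y : X).

(** * Peaking functions with controlled phase *)

Lemma regular_peak (e : R) x (O : set X) :
  0 < e -> choquet_boundary A x -> open O -> O x ->
  exists h : A_, [/\ rnorm h = 1, ev h x = 1 &
    forall y, ~ O y -> cmod (ev h y) < e].
Proof.
move=> e0 xch Oo Ox; have [h [h1 hx hO]] := A_regular e0 xch Oo Ox.
exists h; split.
- by apply/complexI; rewrite -rnormE h1.
- by rewrite evE hx.
- by move=> y Oy; rewrite -ltcR -cmodE evE; exact: hO.
Qed.

Lemma open_ev_near f (c : R[i]) (d : R) :
  open [set y | cmod (ev f y - c) < d].
Proof.
have /asboolP[fc _] := valP (val f).
have [d0|d0] := ltP 0 d; last first.
  rewrite (_ : mkset _ = set0); first exact: open0.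
  apply/seteqP; split=> // y /=; have := cmod_ge0 (ev f y - c); norm_lra.
rewrite (_ : mkset _ = val (val f) @^-1` ball (c : R[i]^o) d%:C).
  by apply: open_comp; [move=> y _; exact: fc|apply: ball_open; rewrite ltcR].
apply/seteqP; split=> y /=; rewrite -ball_normE /ball_/=;
  by rewrite -evE cmodE ltcR cmodB.
Qed.

(** A peaking function [h1] has modulus at most one near [x], but its phase there
    is arbitrary.  Averaging it with a function [h2] that peaks where [h1] is
    close to 1 repairs this: wherever [h2] is not small, [h = (h1 + h2) / 2] lies
    near the disc of centre [1/2] and radius [1/2], elsewhere [|h|] is at most
    about [1/2].  The three bounds on [M] correspond to [y] outside [U], in [U]
    but not in [W], and in [W]. *)
Lemma peak_le f x (v : R[i]) (e M : R) : 0 < e -> choquet_boundary A x ->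
  rnorm f <= M -> cmod (ev f x) + cmod v / 2 <= M ->
  cmod (ev f x + 2^-1%:C * v) + cmod v / 2 <= M ->
  exists h : A_, [/\ rnorm h = 1, ev h x = 1 & rnorm (f + v *: h) <= M + e].
Proof.
move=> e0 xch M1 M2 M3; have v0 := cmod_ge0 v.
have [d d0 dE] : exists2 d : R, 0 < d & d * (1 + cmod v) = e.
  exists (e / (1 + cmod v)); first by rewrite divr_gt0// ltr_pwDl.
  by rewrite divfK// gt_eqF// ltr_pwDl.
have vd0 : 0 <= cmod v * d by rewrite mulr_ge0// ltW.
pose U := [set y | cmod (ev f y - ev f x) < d].
have O1x : U x by rewrite /U /= subrr cmod0.
have [h1 [h11 h1x h1O]] := regular_peak d0 xch (open_ev_near f _ d) O1x.
pose W := U `&` [set y | cmod (ev h1 y - 1) < d].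
have O2x : W x by split=> //=; rewrite h1x subrr cmod0.
have O2o : open W by apply: openI; exact: open_ev_near.
have [h2 [h21 h2x h2O]] := regular_peak d0 xch O2o O2x.
pose h := 2^-1%:C *: (h1 + h2).
have hE y : ev h y = 2^-1%:C * (ev h1 y + ev h2 y) by rewrite evZ evD.
have half : cmod (2^-1%:C : R[i]) = 2^-1 by rewrite cmod_real ger0_norm.
have hx : ev h x = 1.
  rewrite hE h1x h2x; apply/eqP; rewrite eq_complex /=.
  by apply/andP; split; apply/eqP; field.
exists h; split => //.
  apply/eqP; rewrite eq_le; apply/andP; split.
    rewrite rnormZ_ev half; have := rnormD_ev h1 h2; rewrite h11 h21; norm_lra.
  by have := rnorm_ev_le h x; rewrite hx cmod1.
have hle y : cmod (ev h y) <= (cmod (ev h1 y) + cmod (ev h2 y)) / 2.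
  rewrite hE cmodM half; have := cmodD (ev h1 y) (ev h2 y); norm_lra.
apply: rnorm_le => [|y].
  by have := rnorm_ge0 f; norm_lra.
rewrite evD evZ.
have h1y := rnorm_ev_le h1 y; have h2y := rnorm_ev_le h2 y.
rewrite h11 in h1y; rewrite h21 in h2y.
have fy := rnorm_ev_le f y; have tri := cmodD (ev f y) (v * ev h y).
rewrite cmodM in tri; have hy := hle y.
have [yO1|yO1] := pselect (U y); last first.
  have k1 := h1O _ yO1; have k2 := h2O y (fun k => yO1 k.1).
  have : cmod v * cmod (ev h y) <= cmod v * d by apply: ler_wpM2l => //; norm_lra.
  norm_lra.
have fd : cmod (ev f y) <= cmod (ev f x) + d.
  have := cmodD (ev f y - ev f x) (ev f x); rewrite subrK.
  move: yO1; rewrite /U /=; norm_lra.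
have [yO2|yO2] := pselect (W y); last first.
  have k2 := h2O y yO2.
  have : cmod v * cmod (ev h y) <= cmod v * (2^-1 + d / 2).
    by apply: ler_wpM2l => //; norm_lra.
  norm_lra.
have -> : ev f y + v * ev h y = (ev f x + 2^-1%:C * v) +
    ((ev f y - ev f x) + v * (2^-1%:C * (ev h1 y - 1)) + v * (2^-1%:C * ev h2 y)).
  rewrite hE; ring.
apply: le_trans (cmodD _ _) _.
have {}M3 := M3; rewrite -lerBrDr in M3; apply: le_trans (lerD M3 (lexx _)) _.
have := cmodD (ev f y - ev f x + v * (2^-1%:C * (ev h1 y - 1)))
  (v * (2^-1%:C * ev h2 y)).
have := cmodD (ev f y - ev f x) (v * (2^-1%:C * (ev h1 y - 1))).
rewrite !cmodM !half; have [_ /= k1] := yO2.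
have : cmod v * (2^-1 * cmod (ev h1 y - 1)) <= cmod v * (2^-1 * d).
  by apply: ler_wpM2l => //; norm_lra.
have : cmod v * (2^-1 * cmod (ev h2 y)) <= cmod v * 2^-1.
  by apply: ler_wpM2l => //; norm_lra.
move: yO1; rewrite /U /=; norm_lra.
Qed.

(** Contrapositive form of [peak_le], free of epsilons: the phase information is
    extracted from the third alternative by excluding the other two. *)
Lemma peak_bound f x (v : R[i]) (L : R) : choquet_boundary A x ->
  (forall h : A_, rnorm h = 1 -> ev h x = 1 -> L <= rnorm (f + v *: h)) ->
  [\/ L <= rnorm f, L <= cmod (ev f x) + cmod v / 2 |
      L <= cmod (ev f x + 2^-1%:C * v) + cmod v / 2].
Proof.
move=> xch hL; pose M3 := cmod (ev f x + 2^-1%:C * v) + cmod v / 2.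
pose M2 := cmod (ev f x) + cmod v / 2.
have [L1|L1] := leP L (rnorm f); first by constructor 1.
have [L2|L2] := leP L M2; first by constructor 2.
have [L3|L3] := leP L M3; first by constructor 3.
exfalso; pose M := Num.max (rnorm f) (Num.max M2 M3).
have ML : M < L by rewrite /M !gt_max L1 L2 L3.
have e0 : 0 < (L - M) / 2 by rewrite divr_gt0// subr_gt0.
have [||| h [h1 hx hM]] := @peak_le f x v _ M e0 xch.
- by rewrite /M le_max lexx.
- by rewrite /M !le_max lexx orbT.
- by rewrite /M !le_max lexx !orbT.
have := hL h h1 hx; norm_lra.
Qed.

End Peaks.

(** * The faces of the unit sphere *)

Section Faces.
Variables (R : realType) (X : topologicalType) (A : submodClosed (C0 R X)).
Hypothesis X_hausdorff : hausdorff_space X.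
Hypothesis A_regular : extremely_C_regular A.
Local Notation A_ := (subspace_of A).
Variables (B : normedModType R[i]) (I : {linear A_ -> B})
  (D : {linear B -> A_}) (C : {linear B -> R[i]^o}) (e : B).
Hypothesis DI : forall f, D (I f) = f.
Hypothesis CI : forall f, C (I f) = 0.
Hypothesis B_norm : forall a, `|a| = `|C a| + `|D a|.
Hypothesis De : D e = 0.
Hypothesis Ce : C e = 1.
Implicit Types (a b m : B) (c z u w : R[i]) (f g h : A_) (x y : X).

Definition cpart a : R[i] := C a.
Definition dpart a : A_ := D a.
Definition mk c f : B := c *: e + I f.

Lemma cpartD a b : cpart (a + b) = cpart a + cpart b.
Proof. by rewrite /cpart raddfD. Qed.
Lemma cpartN a : cpart (- a) = - cpart a.
Proof. by rewrite /cpart raddfN. Qed.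
Lemma cpartB a b : cpart (a - b) = cpart a - cpart b.
Proof. by rewrite /cpart raddfB. Qed.
Lemma cpartZ c a : cpart (c *: a) = c * cpart a.
Proof. by rewrite /cpart linearZ_LR. Qed.
Lemma dpartD a b : dpart (a + b) = dpart a + dpart b.
Proof. exact: raddfD. Qed.
Lemma dpartN a : dpart (- a) = - dpart a.
Proof. exact: raddfN. Qed.
Lemma dpartB a b : dpart (a - b) = dpart a - dpart b.
Proof. exact: raddfB. Qed.
Lemma dpartZ c a : dpart (c *: a) = c *: dpart a.
Proof. exact: linearZ_LR. Qed.

Lemma cpart_mk c f : cpart (mk c f) = c.
Proof.
by rewrite /mk cpartD cpartZ /cpart Ce CI mulr1 addr0.
Qed.

Lemma dpart_mk c f : dpart (mk c f) = f.
Proof. by rewrite /mk dpartD dpartZ /dpart De scaler0 add0r DI. Qed.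

Lemma rnorm_split a : rnorm a = cmod (cpart a) + rnorm (dpart a).
Proof.
apply/complexI; rewrite rmorphD/= -(rnormE a) B_norm -rnormE.
by rewrite -(cmodE (cpart a)).
Qed.

Lemma rnormD_B a b : rnorm (a + b) <= rnorm a + rnorm b.
Proof. exact: rnormD. Qed.
Lemma rnormN_B a : rnorm (- a) = rnorm a.
Proof. exact: rnormN. Qed.
Lemma rnormZ_B c a : rnorm (c *: a) = cmod c * rnorm a.
Proof. exact: rnormZ. Qed.
Lemma rnormN_ev f : rnorm (- f) = rnorm f.
Proof. exact: rnormN. Qed.

Lemma part_eq a b : cpart a = cpart b -> dpart a = dpart b -> a = b.
Proof.
move=> cab dab; apply/eqP; rewrite -subr_eq0; apply/eqP/rnorm_eq0.
have := rnorm_split (a - b); rewrite cpartB dpartB cab dab !subrr.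
by rewrite cmod0 rnorm0 addr0.
Qed.

Lemma rnorm_mk c f : rnorm (mk c f) = cmod c + rnorm f.
Proof. by rewrite rnorm_split cpart_mk dpart_mk. Qed.

(** The index [(mu, u, x)] of a face; [supf] is its supporting functional and the
    face is the set of unit vectors [a] with [supf p a = 1]. *)
Record face := Face {
  fmu : R[i]; fu : R[i]; fx : X;
  fmu1 : cmod fmu = 1; fu1 : cmod fu = 1; fxch : choquet_boundary A fx }.
Implicit Types p q : face.

Definition supf p a := dot (fmu p) (cpart a) + dot (fu p) (ev (dpart a) (fx p)).

Lemma cmodN1 z : cmod z = 1 -> cmod (- z) = 1. Proof. by rewrite cmodN. Qed.

Definition opp_face p :=
  Face (cmodN1 (fmu1 p)) (cmodN1 (fu1 p)) (fxch p).

Lemma supf_opp p a : supf (opp_face p) a = - supf p a.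
Proof. by rewrite /supf /= !dotNl -opprD. Qed.

Lemma supfD p a b : supf p (a + b) = supf p a + supf p b.
Proof. rewrite /supf cpartD dpartD evD !dotDr; ring. Qed.

Lemma supfN p a : supf p (- a) = - supf p a.
Proof. by rewrite /supf cpartN dpartN evN !dotNr -opprD. Qed.

Lemma supfZ p (r : R) a : supf p (r%:C *: a) = r * supf p a.
Proof. by rewrite /supf cpartZ dpartZ evZ !dotZr mulrDr. Qed.

Lemma supf_mk p c f : supf p (mk c f) = dot (fmu p) c + dot (fu p) (ev f (fx p)).
Proof. by rewrite /supf cpart_mk dpart_mk. Qed.

Lemma supf_le p a : supf p a <= rnorm a.
Proof.
rewrite rnorm_split; have := dot_le (fmu p) (cpart a).
have := dot_le (fu p) (ev (dpart a) (fx p)); have := rnorm_ev_le (dpart a) (fx p).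
rewrite /supf fmu1 fu1 !mul1r; norm_lra.
Qed.

(** Each of the two summands of [supf p a] must attain its own bound. *)
Lemma supf_maxP p a : supf p a = rnorm a <->
  cpart a = (cmod (cpart a))%:C * fmu p /\
  ev (dpart a) (fx p) = (rnorm (dpart a))%:C * fu p.
Proof.
have k1 := dot_le (fmu p) (cpart a).
have k2 := dot_le (fu p) (ev (dpart a) (fx p)); have k3 := rnorm_ev_le (dpart a) (fx p).
rewrite fmu1 mul1r in k1; rewrite fu1 mul1r in k2.
split=> [|[cE dE]].
  rewrite rnorm_split /supf => h.
  have e1 : cmod (cpart a) <= dot (fmu p) (cpart a) by norm_lra.
  have e2 : cmod (ev (dpart a) (fx p)) <= dot (fu p) (ev (dpart a) (fx p)) by norm_lra.
  have e3 : cmod (ev (dpart a) (fx p)) = rnorm (dpart a) by norm_lra.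
  split; first exact: (dot_eq_cmod (fmu1 p)).
  by rewrite -e3; exact: (dot_eq_cmod (fu1 p)).
rewrite rnorm_split /supf cE dE !dotZr -!cmod_sqr fmu1 fu1 expr1n !mulr1.
by rewrite cmodM fmu1 mulr1 cmod_real ger0_norm// cmod_ge0.
Qed.

Lemma supf_max1 p a : rnorm a = 1 -> supf p a = 1 ->
  cpart a = (cmod (cpart a))%:C * fmu p /\
  ev (dpart a) (fx p) = (rnorm (dpart a))%:C * fu p.
Proof. by move=> a1 pa; apply/supf_maxP; rewrite a1. Qed.

(* The two kinds of points of a face used as test points: multiples of [e], and
   multiples of a function peaking at [fx p]. *)
Lemma face_point_c p : rnorm (mk (fmu p) 0) = 1 /\ supf p (mk (fmu p) 0) = 1.
Proof.
by rewrite rnorm_mk supf_mk ev0 dot0r rnorm0 -cmod_sqr fmu1 expr1n !addr0.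
Qed.

Lemma face_point_d p h : rnorm h = 1 -> ev h (fx p) = 1 ->
  rnorm (mk 0 (fu p *: h)) = 1 /\ supf p (mk 0 (fu p *: h)) = 1.
Proof.
move=> h1 hx; rewrite rnorm_mk supf_mk dot0r cmod0 rnormZ_ev evZ fu1 h1 hx.
by rewrite !mulr1 -cmod_sqr fu1 expr1n !add0r.
Qed.

(** The metric characterization of faces: the points at distance 2 from all points
    of the opposite face.  The test point [fmu p * e] determines the phase of [C b]
    and the test points made from peaking functions, through [peak_bound], the
    value of [D b] at [fx p]. *)
Lemma face_of_far p b : rnorm b = 1 ->
  (forall a, rnorm a = 1 -> supf p a = 1 -> rnorm (b + a) = 2) -> supf p b = 1.
Proof.
move=> b1 bF; rewrite -b1; apply/supf_maxP.
have bs := rnorm_split b; rewrite b1 in bs.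
split.
  have [m1 m2] := face_point_c p; have := bF _ m1 m2.
  rewrite rnorm_split cpartD dpartD cpart_mk dpart_mk addr0 => h.
  have mu1 := fmu1 p.
  apply: (@cmodD_eq R _ (fmu p)) => //; rewrite ?mu1 ?mul1r//.
  norm_lra.
set g := dpart b in bs *; set x := fx p; set u := fu p; have u1 : cmod u = 1 := fu1 p.
have L h : rnorm h = 1 -> ev h x = 1 -> 1 + rnorm g <= rnorm (g + u *: h).
  move=> h1 hx; have [m1 m2] := face_point_d h1 hx; have := bF _ m1 m2.
  rewrite rnorm_split cpartD dpartD cpart_mk dpart_mk addr0 -/g -/u; norm_lra.
have gx := rnorm_ev_le g x.
have v1 : cmod (2^-1%:C * u) = 2^-1 by rewrite cmodM u1 mulr1 cmod_real ger0_norm.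
have [] := peak_bound A_regular (fxch p) L; rewrite -?/x ?u1;
  [by move=> k; exfalso; norm_lra|by move=> k; exfalso; norm_lra|].
move=> h; have := cmodD (ev g x) (2^-1%:C * u); rewrite v1 => h'.
have <- : cmod (ev g x) = rnorm g by norm_lra.
apply: (@cmodD_eq R _ (2^-1%:C * u)); rewrite ?v1//; norm_lra.
Qed.

Lemma singleton_open x : open (~` [set x]).
Proof.
by apply: closed_openC; exact: accessible_closed_set1 (hausdorff_accessible X_hausdorff) x.
Qed.

Lemma far_peak (d : R) x y : 0 < d -> choquet_boundary A x -> x <> y ->
  exists h, [/\ rnorm h = 1, ev h x = 1 & cmod (ev h y) < d].
Proof.
move=> d0 xch xy; have [h [h1 hx hO]] := regular_peak A_regular d0 xch (@singleton_open y) xy.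
by exists h; split => //; apply: hO => /(_ erefl).
Qed.

Lemma dot1_eq z w : cmod z = 1 -> cmod w = 1 -> dot z w = 1 -> z = w.
Proof.
move=> z1 w1 zw; have := @dot_eq_cmod R w z w1.
by rewrite dotC zw z1 lexx mul1r => ->.
Qed.

(** Faces are pairwise incomparable: the test points of [face_point_c] and
    [face_point_d] recover the index. *)
Lemma face_sub_eq p q :
  (forall a, rnorm a = 1 -> supf p a = 1 -> supf q a = 1) ->
  [/\ fmu p = fmu q, fu p = fu q & fx p = fx q].
Proof.
move=> pq; have [m1 m2] := face_point_c p.
have mE : fmu p = fmu q.
  apply/esym/dot1_eq; rewrite ?fmu1//.
  by have := pq _ m1 m2; rewrite supf_mk ev0 dot0r addr0.
have xE : fx p = fx q.
  apply: contrapT => xy.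
  have [h [h1 hx hy]] := far_peak (ltr01 : 0 < 1 :> R) (fxch p) xy.
  have [k1 k2] := face_point_d h1 hx.
  have := pq _ k1 k2; rewrite supf_mk dot0r add0r evZ.
  have := dot_le (fu q) (fu p * ev h (fx q)).
  rewrite cmodM !fu1 !mul1r; norm_lra.
split=> //.
have [h [h1 hx _]] := regular_peak A_regular (ltr01 : 0 < 1 :> R) (fxch p)
  openT (Logic.I : setT (fx p)).
have [k1 k2] := face_point_d h1 hx.
have := pq _ k1 k2; rewrite supf_mk dot0r add0r evZ -xE hx mulr1 => k.
by apply/esym/dot1_eq; rewrite ?fu1.
Qed.

Lemma supf_eq p q : fmu p = fmu q -> fu p = fu q -> fx p = fx q -> supf p = supf q.
Proof. by rewrite /supf => -> -> ->. Qed.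

(** [choquet_norming] for [B].  The point [x0] serves when [D] vanishes on [Q]. *)
Lemma face_exists x0 (Q : set B) : choquet_boundary A x0 ->
  (forall a b, Q a -> Q b -> Q (a + b)) ->
  (forall a b, Q a -> Q b -> rnorm (a + b) = rnorm a + rnorm b) ->
  exists p, forall a, Q a -> supf p a = rnorm a.
Proof.
move=> x0ch QD Qn.
have Qcd a b : Q a -> Q b ->
    cmod (cpart a + cpart b) = cmod (cpart a) + cmod (cpart b) /\
    rnorm (dpart a + dpart b) = rnorm (dpart a) + rnorm (dpart b).
  move=> Qa Qb; have := Qn a b Qa Qb.
  rewrite !rnorm_split cpartD dpartD.
  have := cmodD (cpart a) (cpart b); have := rnormD_ev (dpart a) (dpart b).
  by split; norm_lra.
have [mu mu1 muP] : exists2 mu, cmod mu = 1 &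
    forall a, Q a -> cpart a = (cmod (cpart a))%:C * mu.
  have [[a0 [Qa0 a00]]|none] := pselect (exists a, Q a /\ cpart a <> 0).
    have [mu mu1 a0E] := polar (cpart a0); exists mu => // a Qa.
    apply: (@cmodD_eq R _ (cpart a0)) => //; first exact: cmod_gt0.
    by have [-> _] := Qcd _ _ Qa Qa0.
  exists 1; rewrite ?cmod1// => a Qa.
  have -> : cpart a = 0 by apply: contrapT => a0; apply: none; exists a.
  by rewrite cmod0 mul0r.
have [x [u [xch u1 xuP]]] : exists x u, [/\ choquet_boundary A x, cmod u = 1 &
    forall a, Q a -> ev (dpart a) x = (rnorm (dpart a))%:C * u].
  have [[a0 [Qa0 a00]]|none] := pselect (exists a, Q a /\ dpart a <> 0).
    have [||||x [u [xch u1 xuP]]] := @choquet_norming R X A (dpart @` Q) (dpart a0) => //.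
    - by move=> _ _ [a Qa <-] [b Qb <-]; exists (a + b); [exact: QD|exact: dpartD].
    - by move=> _ _ [a Qa <-] [b Qb <-]; have [] := Qcd _ _ Qa Qb.
    by exists x, u; split=> // a Qa; apply: xuP; exists a.
  exists x0, 1; split; rewrite ?cmod1// => a Qa.
  have -> : dpart a = 0 by apply: contrapT => a0; apply: none; exists a.
  by rewrite ev0 rnorm0 mul0r.
exists (Face mu1 u1 xch) => a Qa; apply/supf_maxP; split; first exact: muP.
exact: xuP.
Qed.

Lemma supf_norming x0 a : choquet_boundary A x0 -> exists p, supf p a = rnorm a.
Proof.
move=> x0ch.
have rE (r : R) : 0 <= r -> rnorm (r%:C *: a) = r * rnorm a.
  by move=> r0; rewrite rnormZ_B cmod_real ger0_norm.
have [||p pP] := @face_exists x0 [set b | exists2 r : R, 0 <= r & b = r%:C *: a] x0ch.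
- move=> _ _ [r r0 ->] [s s0 ->]; exists (r + s); first exact: addr_ge0.
  by rewrite rmorphD/= scalerDl.
- move=> _ _ [r r0 ->] [s s0 ->]; rewrite -scalerDl -rmorphD !rE ?addr_ge0//.
  by rewrite mulrDl.
by exists p; apply: pP; exists 1; rewrite ?rmorph1 ?scale1r.
Qed.

(** * Sphere isometries permute the faces *)

(** A surjective isometry of the sphere with its inverse, both as total maps; the
    definition is symmetric in [d] and [d'], so each lemma also applies to the
    inverse. *)
Record sphere_iso (d d' : B -> B) : Prop := SphereIso {
  iso_unit : forall a, rnorm a = 1 -> rnorm (d a) = 1;
  iso_unitV : forall a, rnorm a = 1 -> rnorm (d' a) = 1;
  isoK : forall a, rnorm a = 1 -> d' (d a) = a;
  isoKV : forall a, rnorm a = 1 -> d (d' a) = a;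
  iso_dist : forall a b, rnorm a = 1 -> rnorm b = 1 ->
    rnorm (d a - d b) = rnorm (a - b) }.

Lemma sphere_iso_sym d d' : sphere_iso d d' -> sphere_iso d' d.
Proof.
move=> dd'; split; try by case: dd'.
move=> a b a1 b1.
by rewrite -(iso_dist dd') ?(iso_unitV dd')// !(isoKV dd').
Qed.

(** [d] maps the face [p] onto the face [q]. *)
Definition face_rel (d : B -> B) p q :=
  forall a, rnorm a = 1 -> (supf p a = 1 <-> supf q (d a) = 1).

Lemma face_rel_sym d d' p q : sphere_iso d d' ->
  face_rel d p q -> face_rel d' q p.
Proof.
move=> dd' pq a a1; rewrite (pq (d' a)) ?(iso_unitV dd')//.
by rewrite (isoKV dd').
Qed.

Lemma half_add b : 2^-1%:C *: (b + b) = b.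
Proof.
rewrite scalerDr -scalerDl -(rmorphD (real_complex R)).
have -> : 2^-1 + 2^-1 = 1 :> R by field.
by rewrite scale1r.
Qed.

(** For points [m] of the face [p] consider the unit vectors [- d m].  If [m] is
    the midpoint of [m1] and [m2], every face containing [- d m] contains
    [- d m1] and [- d m2]: by [face_of_far] this is a statement about distances
    equal to 2, which [d] preserves and which pass from the midpoint to its
    ends.  So the vectors supported by all faces through some [- d m] form a
    family with additive norm, and [face_exists] yields one face containing every
    [- d m]; the opposite face then contains the image of [p]. *)
Lemma face_into d d' p : sphere_iso d d' ->
  exists q, forall a, rnorm a = 1 -> supf p a = 1 -> supf q (d a) = 1.
Proof.
move=> dd'.
pose mid m1 m2 : B := 2^-1%:C *: (m1 + m2).
have half : cmod (2^-1%:C : R[i]) = 2^-1 by rewrite cmod_real ger0_norm.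
have mid1 m1 m2 : rnorm m1 = 1 -> rnorm m2 = 1 -> supf p m1 = 1 -> supf p m2 = 1 ->
    rnorm (mid m1 m2) = 1 /\ supf p (mid m1 m2) = 1.
  move=> m11 m21 pm1 pm2; have pm : supf p (mid m1 m2) = 1.
    by rewrite supfZ supfD pm1 pm2; field.
  split=> //; apply/eqP; rewrite eq_le -{2}pm supf_le andbT.
  by rewrite rnormZ_B half; have := rnormD_B m1 m2; norm_lra.
have mid_far m1 m2 b : rnorm m1 = 1 -> rnorm m2 = 1 -> rnorm b = 1 ->
    rnorm (b - mid m1 m2) = 2 -> rnorm (b - m1) = 2.
  move=> m11 m21 b1 bm.
  have bE : b - mid m1 m2 = 2^-1%:C *: ((b - m1) + (b - m2)).
    by rewrite /mid addrACA -opprD scalerBr half_add.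
  move: bm; rewrite bE rnormZ_B half => bm.
  have := rnormD_B (b - m1) (b - m2); have := rnormD_B b (- m1); have := rnormD_B b (- m2).
  by rewrite !rnormN_B; norm_lra.
have mid_face m1 m2 q : rnorm m1 = 1 -> rnorm m2 = 1 ->
    rnorm (mid m1 m2) = 1 -> supf q (- d (mid m1 m2)) = 1 -> supf q (- d m1) = 1.
  move=> m11 m21 m1' qm; apply: face_of_far; first by rewrite rnormN_B (iso_unit dd').
  move=> a a1 qa; rewrite addrC -(isoKV dd' a1) (iso_dist dd') ?(iso_unitV dd')//.
  apply: (mid_far m1 m2) => //; first exact: (iso_unitV dd').
  rewrite -(iso_dist dd') ?(iso_unitV dd')// (isoKV dd')//.
  apply/eqP; rewrite eq_le; apply/andP; split.
    by have := rnormD_B a (- d (mid m1 m2)); rewrite rnormN_B (iso_unit dd')// a1; norm_lra.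
  by have := supf_le q (a - d (mid m1 m2)); rewrite supfD qa qm; norm_lra.
pose Q b := exists m, [/\ rnorm m = 1, supf p m = 1 &
  forall q, supf q (- d m) = 1 -> supf q b = rnorm b].
have QQ b1 b2 : Q b1 -> Q b2 -> exists m, [/\ rnorm m = 1, supf p m = 1 &
    forall q, supf q (- d m) = 1 -> supf q b1 = rnorm b1 /\ supf q b2 = rnorm b2].
  move=> [m1 [m11 pm1 m1Q]] [m2 [m21 pm2 m2Q]].
  have [m1' pm] := mid1 _ _ m11 m21 pm1 pm2.
  exists (mid m1 m2); split=> // q qm; split.
    by apply: m1Q; exact: (mid_face m1 m2).
  by apply: m2Q; apply: (mid_face m2 m1); rewrite /mid 1?addrC.
have Qn b1 b2 : Q b1 -> Q b2 -> rnorm (b1 + b2) = rnorm b1 + rnorm b2.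
  move=> Qb1 Qb2; have [m [m1 pm mQ]] := QQ _ _ Qb1 Qb2.
  have [q qm] := supf_norming (- d m) (fxch p).
  have [q1 q2] : supf q b1 = rnorm b1 /\ supf q b2 = rnorm b2.
    by apply: mQ; rewrite qm rnormN_B (iso_unit dd').
  have := supf_le q (b1 + b2); rewrite supfD; have := rnormD_B b1 b2.
  by move=> k1 k2; apply/eqP; rewrite eq_le k1/=; norm_lra.
have QD b1 b2 : Q b1 -> Q b2 -> Q (b1 + b2).
  move=> Qb1 Qb2; have [m [m1 pm mQ]] := QQ _ _ Qb1 Qb2.
  exists m; split=> // q qm; have [q1 q2] := mQ q qm.
  by rewrite supfD q1 q2 Qn.
have [q qQ] := face_exists (fxch p) QD Qn.
exists (opp_face q) => a a1 pa; rewrite supf_opp -supfN.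
have -> : supf q (- d a) = rnorm (- d a).
  by apply: qQ; exists a; split=> // q' ->; rewrite rnormN_B (iso_unit dd').
by rewrite rnormN_B (iso_unit dd').
Qed.

(** [d] maps [p] into some [q] and its inverse maps [q] into some face, which
    contains [p] and hence is [p] by incomparability. *)
Lemma face_rel_exists d d' p : sphere_iso d d' -> exists q, face_rel d p q.
Proof.
move=> dd'; have [q pq] := face_into p dd'; exists q => a a1.
split=> [|qa]; first exact: pq.
have [p2 qp2] := face_into q (sphere_iso_sym dd').
have [e1 e2 e3] : [/\ fmu p = fmu p2, fu p = fu p2 & fx p = fx p2].
  apply: face_sub_eq => b b1 pb; rewrite -(isoK dd' b1).
  by apply: qp2; [exact: (iso_unit dd')|exact: pq].
by rewrite (supf_eq e1 e2 e3) -(isoK dd' a1); apply: qp2; rewrite ?(iso_unit dd').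
Qed.

Lemma face_rel_inj d d' p q p2 q2 : sphere_iso d d' ->
  face_rel d p q -> face_rel d p2 q2 ->
  fmu q = fmu q2 -> fu q = fu q2 -> fx q = fx q2 ->
  [/\ fmu p = fmu p2, fu p = fu p2 & fx p = fx p2].
Proof.
move=> dd' pq pq2 e1 e2 e3; apply: face_sub_eq => a a1 pa.
by apply/(pq2 _ a1); rewrite -(supf_eq e1 e2 e3); apply/(pq _ a1).
Qed.

(** A point of the opposite of [p] is at distance 2 from all of [p]; its image is
    at distance 2 from all of [q], which puts it in the opposite of [q]. *)
Lemma face_rel_opp d d' p q : sphere_iso d d' ->
  face_rel d p q -> face_rel d (opp_face p) (opp_face q).
Proof.
have main d0 d0' p0 q0 b : sphere_iso d0 d0' -> face_rel d0 p0 q0 ->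
    rnorm b = 1 -> supf (opp_face p0) b = 1 -> supf (opp_face q0) (d0 b) = 1.
  move=> dd' pq b1 pb; rewrite supf_opp -supfN; apply: face_of_far.
    by rewrite rnormN_B (iso_unit dd').
  move=> a a1 qa; rewrite addrC -(isoKV dd' a1) (iso_dist dd') ?(iso_unitV dd')//.
  have a1' := iso_unitV dd' a1.
  have pa : supf p0 (d0' a) = 1 by apply/(pq _ a1'); rewrite (isoKV dd').
  apply/eqP; rewrite eq_le; apply/andP; split.
    by have := rnormD_B (d0' a) (- b); rewrite rnormN_B a1' b1; norm_lra.
  move: pb; rewrite supf_opp => pb.
  by have := supf_le p0 (d0' a - b); rewrite supfD supfN pa; norm_lra.
move=> dd' pq b b1; split=> [|qb]; first exact: main dd' pq b1.
rewrite -(isoK dd' b1).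
exact: main (sphere_iso_sym dd') (face_rel_sym dd' pq) (iso_unit dd' b1) qb.
Qed.

(* The sharp constant is the square root of 1/2; what matters is that it exceeds
   1/2, so that two such bounds add up to more than 1. *)
Lemma obtuse_far z w c c' : cmod z = 1 -> cmod w = 1 -> dot z w <= 0 ->
  c = (cmod c)%:C * z -> c' = (cmod c')%:C * w ->
  7 / 10 * (cmod c + cmod c') <= cmod (c - c').
Proof.
move=> z1 w1 zw cE c'E; have s0 := cmod_ge0 c; have t0 := cmod_ge0 c'.
have := cmodD_sqr c (- c'); rewrite cmodN dotNr {3}cE {2}c'E dotZl dotZr.
have k : cmod c * (cmod c' * dot z w) <= 0.
  by rewrite mulrA mulr_ge0_le0// mulr_ge0.
move=> h; rewrite leNgt; apply/negP => hlt.
have : cmod (c - c') ^+ 2 < (7 / 10 * (cmod c + cmod c')) ^+ 2.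
  by rewrite ltr_pXn2r// nnegrE ?cmod_ge0// mulr_ge0// addr_ge0.
rewrite h; have := sqr_ge0 (cmod c - cmod c'); norm_nra.
Qed.

Lemma obtuse_faces_far p q a b : fx p = fx q ->
  dot (fmu p) (fmu q) <= 0 -> dot (fu p) (fu q) <= 0 ->
  rnorm a = 1 -> rnorm b = 1 -> supf p a = 1 -> supf q b = 1 ->
  14 / 10 <= rnorm (a - b).
Proof.
move=> xE muo uo a1 b1 pa qb.
have [ca da] := supf_max1 a1 pa; have [cb db] := supf_max1 b1 qb.
rewrite rnorm_split cpartB dpartB.
have := rnorm_ev_le (dpart a - dpart b) (fx p); rewrite evB.
have da' : cmod (ev (dpart a) (fx p)) = rnorm (dpart a).
  by rewrite da cmodM fu1 mulr1 cmod_real ger0_norm ?rnorm_ge0.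
have db' : cmod (ev (dpart b) (fx p)) = rnorm (dpart b).
  by rewrite xE db cmodM fu1 mulr1 cmod_real ger0_norm ?rnorm_ge0.
have := obtuse_far (fmu1 p) (fmu1 q) muo ca cb.
have := obtuse_far (fu1 p) (fu1 q) uo (_ : ev (dpart a) (fx p) = _)
  (_ : ev (dpart b) (fx p) = _).
rewrite da' db' -da xE -db => /(_ erefl erefl).
have := rnorm_split a; have := rnorm_split b; rewrite a1 b1; norm_lra.
Qed.

(** If [fx p'] and [fx q'] differed, peaking functions at these two points would
    provide points of the image faces at distance at most 1.2, contradicting the
    lower bound 1.4 for [p] and [q]. *)
Lemma obtuse_same_x d d' p q p' q' : sphere_iso d d' ->
  face_rel d p p' -> face_rel d q q' -> fx p = fx q ->
  dot (fmu p) (fmu q) <= 0 -> dot (fu p) (fu q) <= 0 -> fx p' = fx q'.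
Proof.
move=> dd' pp' qq' xE muo uo; apply: contrapT => x'E.
have d0 : 0 < 1 / 10 :> R by rewrite divr_gt0.
have [h2 [h21 h2x h2y]] := far_peak d0 (fxch q') (nesym x'E).
pose f : A_ := - (fu q' *: h2).
have f1 : rnorm f = 1 by rewrite rnormN_ev rnormZ_ev h21 fu1 mulr1.
have fx' : cmod (ev f (fx p')) < 1 / 10.
  by rewrite evN evZ cmodN cmodM fu1 mul1r.
have [|||h1 [h11 h1x h1M]] := @peak_le _ _ _ A_regular f (fx p') (fu p') _ (11 / 10) d0 (fxch p').
- by rewrite f1; norm_lra.
- by rewrite fu1; norm_lra.
- have := cmodD (ev f (fx p')) (2^-1%:C * fu p').
  rewrite cmodM fu1 cmod_real ger0_norm ?mulr1; norm_lra.
have [a1 pa] := face_point_d h11 h1x; have [b1 qb] := face_point_d h21 h2x.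
have := obtuse_faces_far xE muo uo (iso_unitV dd' a1) (iso_unitV dd' b1)
  ((pp' _ (iso_unitV dd' a1)).2 _) ((qq' _ (iso_unitV dd' b1)).2 _).
rewrite !(isoKV dd')// => /(_ pa qb).
rewrite (iso_dist (sphere_iso_sym dd'))// rnorm_split cpartB dpartB !cpart_mk !dpart_mk.
have -> : fu p' *: h1 - fu q' *: h2 = f + fu p' *: h1 by rewrite addrC.
by rewrite subrr cmod0 add0r => /le_trans/(_ h1M); norm_lra.
Qed.

Lemma exists_perp z : cmod z = 1 -> exists2 k, cmod k = 1 & dot z k = 0.
Proof.
move=> z1; exists ('i * z); last first.
  by rewrite dot.unlock; case: (z) => x y /=; ring.
rewrite cmodM z1 mulr1; have := cmod_sqr ('i : R[i]).
rewrite dot.unlock /= mulr0 mulr1 add0r => /eqP.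
by rewrite sqrp_eq1 ?cmod_ge0// => /eqP.
Qed.

Lemma between_obtuse z w : cmod z = 1 ->
  exists2 k, cmod k = 1 & dot z k <= 0 /\ dot k w <= 0.
Proof.
move=> z1; have [k k1 zk] := exists_perp z1.
have [kw|kw] := leP (dot k w) 0; first by exists k; rewrite ?zk.
exists (- k); first by rewrite cmodN.
by rewrite dotNr zk dotNl; split; norm_lra.
Qed.

(** Any two pairs of phases are joined through a third one that is obtuse to both,
    so [obtuse_same_x] extends to all faces over the same point. *)
Lemma same_x d d' p q p' q' : sphere_iso d d' ->
  face_rel d p p' -> face_rel d q q' -> fx p = fx q -> fx p' = fx q'.
Proof.
move=> dd' pp' qq' xE.
have [k k1 [pk kq]] := between_obtuse (fmu q) (fmu1 p).
have [v v1 [pv vq]] := between_obtuse (fu q) (fu1 p).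
have [r rr'] := face_rel_exists (Face k1 v1 (fxch p)) dd'.
by rewrite (obtuse_same_x dd' pp' rr')// (obtuse_same_x dd' rr' qq').
Qed.

(** * Images of the multiples of e *)

Lemma eq_0_choquet : ~ (exists x, choquet_boundary A x) -> forall f, f = 0.
Proof.
move=> none f; apply: contrapT => f0.
have rE (r : R) : 0 <= r -> rnorm (r%:C *: f) = r * rnorm f.
  by move=> r0; rewrite rnormZ_ev cmod_real ger0_norm.
have [||||x [u [xch _ _]]] := @choquet_norming R X A
    [set g | exists2 r : R, 0 <= r & g = r%:C *: f] f.
- by exists 1; rewrite ?rmorph1 ?scale1r.
- by [].
- move=> _ _ [r r0 ->] [s s0 ->]; exists (r + s); first exact: addr_ge0.
  by rewrite rmorphD/= scalerDl.
- move=> _ _ [r r0 ->] [s s0 ->]; rewrite -scalerDl -rmorphD !rE ?addr_ge0//.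
  by rewrite mulrDl.
by apply: none; exists x.
Qed.

(** [mk mu 0] lies in the faces [(mu, 1, x)] and [(mu, -1, x)].  Their images lie
    over the same point and are distinct, so they differ in one of the two phases;
    a common element must vanish in the corresponding coordinate. *)
Lemma axis_or d d' x mu : sphere_iso d d' -> choquet_boundary A x ->
  cmod mu = 1 -> cpart (d (mk mu 0)) = 0 \/ dpart (d (mk mu 0)) = 0.
Proof.
move=> dd' xch mu1; set b := d _.
pose p := Face mu1 (cmod1 R) xch; pose q := Face mu1 (cmodN1 (cmod1 R)) xch.
have [p' pp'] := face_rel_exists p dd'; have [q' qq'] := face_rel_exists q dd'.
have [a1 pa] := face_point_c p; have [_ qa] := face_point_c q.
have b1 : rnorm b = 1 by exact: (iso_unit dd').
have [cp dp] := supf_max1 b1 ((pp' _ a1).1 pa).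
have [cq dq] := supf_max1 b1 ((qq' _ a1).1 qa).
have x'E := same_x dd' pp' qq' (erefl : fx p = fx q).
have [->|c0] := pselect (cpart b = 0); first by left.
have [->|d0] := pselect (dpart b = 0); first by right.
have muE : fmu p' = fmu q'.
  by apply: (scaled_inj (cmod_gt0 c0)); rewrite -cp -cq.
have uE : fu p' = fu q'.
  by apply: (scaled_inj (rnorm_gt0 d0)); rewrite -dp -dq x'E.
have [_ /= /eqP + _] := face_rel_inj dd' pp' qq' muE uE x'E.
by rewrite eq_sym -subr_eq0 -opprD oppr_eq0 (_ : 1 + 1 = 2%:R)// pnatr_eq0.
Qed.

Lemma rnorm_dpart_off_axis a : rnorm a = 1 -> cpart a = 0 -> rnorm (dpart a) = 1.
Proof. by rewrite rnorm_split => + c0; rewrite c0 cmod0 add0r. Qed.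

Lemma cmod_cpart_axis a : rnorm a = 1 -> dpart a = 0 -> cmod (cpart a) = 1.
Proof. by rewrite rnorm_split => + c0; rewrite c0 rnorm0 addr0. Qed.

Lemma mk_axis a : dpart a = 0 -> a = mk (cpart a) 0.
Proof. by move=> d0; apply: part_eq; rewrite ?cpart_mk ?dpart_mk. Qed.

Lemma rnorm_axis mu : cmod mu = 1 -> rnorm (mk mu 0) = 1.
Proof. by move=> mu1; rewrite rnorm_mk mu1 rnorm0 addr0. Qed.

(** If [b = d (mk mu 0)] lies in the kernel of [C], then [dpart b] is, up to a
    phase, equal to every norm-one [h] with [h x' = 1].  Indeed [mk 0 (u' h)]
    belongs to two faces that differ only in [mu'], whose preimages are
    two faces with first phase [mu], so its preimage is [mk mu 0].  Such an [h]
    can be chosen with [|h y'| < 1] for a given other point [y'], but all the faces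
    [(mu, 1, y)] contain [mk mu 0], so [dpart b] is unimodular at each image
    point [y'].  Hence [x'] is the only image point, and [same_x] for the inverse
    gives [y = x]. *)
Lemma off_axis_singleton d d' x mu : sphere_iso d d' ->
  choquet_boundary A x -> cmod mu = 1 -> dpart (d (mk mu 0)) <> 0 ->
  forall y, choquet_boundary A y -> y = x.
Proof.
move=> dd' xch mu1 db; set b := d (mk mu 0) in db.
have a1 := rnorm_axis mu1.
have b1 : rnorm b = 1 by exact: (iso_unit dd').
have cb : cpart b = 0 by have [] := axis_or dd' xch mu1.
have db1 := rnorm_dpart_off_axis b1 cb.
pose p := Face mu1 (cmod1 R) xch; have [p' pp'] := face_rel_exists p dd'.
have p'b : supf p' b = 1 by apply/(pp' _ a1); have [] := face_point_c p.
have [_] := supf_max1 b1 p'b; rewrite db1 rmorph1 mul1r => bx'.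
have uniq h : rnorm h = 1 -> ev h (fx p') = 1 -> dpart b = fu p' *: h.
  move=> h1 hx; have [g1 p'g] := face_point_d h1 hx.
  set g := mk 0 _ in g1 p'g; pose a := d' g.
  have a1' : rnorm a = 1 by exact: (iso_unitV dd').
  (* the other face containing both [b] and [g] *)
  pose q' := Face (cmodN1 (fmu1 p')) (fu1 p') (fxch p').
  have [q q'q] := face_rel_exists q' (sphere_iso_sym dd').
  have xE : fx q = fx p.
    exact: same_x (sphere_iso_sym dd') q'q (face_rel_sym dd' pp') _.
  have q'b : supf q' b = 1.
    by move: p'b; rewrite /supf /= cb !dot0r.
  have q'g : supf q' g = 1.
    by move: p'g; rewrite !supf_mk /= !dot0r.
  have qmu : supf q (mk mu 0) = 1.
    by rewrite -(isoK dd' a1); apply/(q'q _ b1).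
  have muE : fmu q = mu.
    by apply: dot1_eq; rewrite ?fmu1//; move: qmu; rewrite supf_mk ev0 dot0r addr0.
  have [cp dp] := supf_max1 a1' ((face_rel_sym dd' pp' g1).1 p'g).
  have [_ dq] := supf_max1 a1' ((q'q _ g1).1 q'g).
  have da0 : dpart a = 0.
    apply: contrapT => d0.
    have uE : fu p = fu q.
      by apply: (scaled_inj (rnorm_gt0 d0)); rewrite -dp -dq xE.
    have [/= + _ _] := face_rel_inj (sphere_iso_sym dd')
      (face_rel_sym dd' pp') q'q (esym muE) uE (esym xE).
    move=> /eqP; rewrite -subr_eq0 opprK -mulr2n mulrn_eq0/= => /eqP k0.
    by have := fmu1 p'; rewrite k0 cmod0 => /eqP; rewrite eq_sym oner_eq0.
  have aE : a = mk mu 0.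
    by rewrite (mk_axis da0) cp (cmod_cpart_axis a1' da0) rmorph1 mul1r.
  have -> : b = g by rewrite /b -aE /a (isoKV dd').
  by rewrite dpart_mk.
move=> y ych; pose q := Face mu1 (cmod1 R) ych.
have [q' qq'] := face_rel_exists q dd'.
suff x'E : fx q' = fx p'.
  exact: same_x (sphere_iso_sym dd') (face_rel_sym dd' qq')
    (face_rel_sym dd' pp') x'E.
apply: contrapT => x'y'.
have [h [h1 hx hy]] := far_peak (ltr01 : 0 < 1 :> R) (fxch p') (nesym x'y').
have q'b : supf q' b = 1 by apply/(qq' _ a1); have [] := face_point_c q.
have [_] := supf_max1 b1 q'b; rewrite db1 rmorph1 mul1r (uniq h)// evZ => k.
have := congr1 (@cmod R) k; rewrite cmodM !fu1 mul1r => k1.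
by rewrite k1 ltxx in hy.
Qed.

(** [d] maps the circle of multiples of [e] into itself. *)
Definition axis d := forall mu, cmod mu = 1 -> dpart (d (mk mu 0)) = 0.

(** The images lie in different summands, so they are at distance 2, and so are
    the two points themselves. *)
Lemma axis_dist d d' x mu nu : sphere_iso d d' -> choquet_boundary A x ->
  cmod mu = 1 -> cmod nu = 1 ->
  dpart (d (mk mu 0)) = 0 -> dpart (d (mk nu 0)) <> 0 -> dot mu nu = -1.
Proof.
move=> dd' xch mu1 nu1 dmu dnu.
have cnu : cpart (d (mk nu 0)) = 0 by have [] := axis_or dd' xch nu1.
have := iso_dist dd' (rnorm_axis mu1) (rnorm_axis nu1).
rewrite !rnorm_split !cpartB !dpartB !cpart_mk !dpart_mk dmu cnu !subr0 sub0r.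
rewrite rnormN_ev rnorm0 addr0.
rewrite (cmod_cpart_axis _ dmu) ?(iso_unit dd' (rnorm_axis _))//.
rewrite (rnorm_dpart_off_axis _ cnu) ?(iso_unit dd' (rnorm_axis _))// => k.
have := cmodD_sqr mu (- nu); rewrite -k cmodN mu1 nu1 dotNr; norm_lra.
Qed.

(** By [axis_dist], a unit orthogonal to [mu] cannot be off the axis, and then no
    unit can be opposite to both. *)
Lemma axis_all d d' mu : sphere_iso d d' -> cmod mu = 1 ->
  dpart (d (mk mu 0)) = 0 -> axis d.
Proof.
move=> dd' mu1 dmu nu nu1.
have [[x xch]|none] := pselect (exists x, choquet_boundary A x); last first.
  exact: eq_0_choquet.
apply: contrapT => dnu; have [k k1 muk] := exists_perp mu1.
have dk : dpart (d (mk k 0)) = 0.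
  apply: contrapT => dk; have := axis_dist dd' xch mu1 k1 dmu dk.
  by rewrite muk => /eqP; rewrite eq_sym oppr_eq0 oner_eq0.
have m := axis_dist dd' xch mu1 nu1 dmu dnu.
have m' := axis_dist dd' xch k1 nu1 dk dnu.
have muE : - mu = nu by apply: dot1_eq; rewrite ?cmodN// dotNl m opprK.
have kE : - k = nu by apply: dot1_eq; rewrite ?cmodN// dotNl m' opprK.
move: muk; rewrite -(opprK k) kE -muE opprK -cmod_sqr mu1 expr1n => /eqP.
by rewrite oner_eq0.
Qed.

(** * The first coordinate *)

Section Axis.
Variables d d' : B -> B.
Hypothesis dd' : sphere_iso d d'.
Hypothesis d_axis : axis d.

Definition axis_phase mu := cpart (d (mk mu 0)).

Lemma axis_image mu : cmod mu = 1 -> d (mk mu 0) = mk (axis_phase mu) 0.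
Proof. by move=> mu1; apply: mk_axis; exact: d_axis. Qed.

Lemma cmod_axis_phase mu : cmod mu = 1 -> cmod (axis_phase mu) = 1.
Proof.
move=> mu1; apply: cmod_cpart_axis; last exact: d_axis.
by apply: (iso_unit dd'); exact: rnorm_axis.
Qed.

Lemma dot_axis_phase mu nu : cmod mu = 1 -> cmod nu = 1 ->
  dot (axis_phase mu) (axis_phase nu) = dot mu nu.
Proof.
move=> mu1 nu1; have := iso_dist dd' (rnorm_axis mu1) (rnorm_axis nu1).
rewrite !axis_image// !rnorm_split !cpartB !dpartB !cpart_mk !dpart_mk subrr rnorm0 !addr0.
move=> k; have := cmodD_sqr mu (- nu); have := cmodD_sqr (axis_phase mu) (- axis_phase nu).
rewrite k !cmodN !cmod_axis_phase// mu1 nu1 !dotNr; norm_lra.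
Qed.

(** The distance from [a] to the nearest of the unit multiples of [e],
    computed on both sides of [d]. *)
Lemma axis_phase_dist a mu : rnorm a = 1 -> cmod mu = 1 ->
  cpart a = (cmod (cpart a))%:C * mu ->
  cmod (cpart (d a) - axis_phase mu) + (1 - cmod (cpart (d a))) =
  2 * (1 - cmod (cpart a)).
Proof.
move=> a1 mu1 aE; have da1 := iso_unit dd' a1.
have := iso_dist dd' a1 (rnorm_axis mu1); rewrite axis_image// [LHS]rnorm_split.
rewrite [RHS]rnorm_split !cpartB !dpartB !cpart_mk !dpart_mk !subr0.
have -> : cmod (cpart a - mu) = 1 - cmod (cpart a).
  have c1 : cmod (cpart a) <= 1.
    by have := rnorm_split a; have := rnorm_ge0 (dpart a); norm_lra.
  have -> : cpart a - mu = - ((1 - cmod (cpart a))%:C * mu).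
    by rewrite {1}aE rmorphB/= rmorph1 mulrBl mul1r opprB.
  by rewrite cmodN cmod_scaled// subr_ge0.
have := rnorm_split a; have := rnorm_split (d a); rewrite a1 da1; norm_lra.
Qed.

Lemma cmod_cpart_le a : rnorm a = 1 -> cmod (cpart a) <= cmod (cpart (d a)).
Proof.
move=> a1; have [mu mu1 aE] := polar (cpart a).
have := axis_phase_dist a1 mu1 aE.
have := cmodD (cpart (d a)) (axis_phase mu - cpart (d a)); rewrite addrC subrK.
rewrite cmod_axis_phase// cmodB; norm_lra.
Qed.

Lemma face_rel_mu p q : face_rel d p q -> fmu q = axis_phase (fmu p).
Proof.
move=> pq; have [a1 pa] := face_point_c p.
have := (pq _ a1).1 pa; rewrite axis_image ?fmu1// supf_mk ev0 dot0r addr0 => k.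
by apply: dot1_eq; rewrite ?cmod_axis_phase ?fmu1.
Qed.

End Axis.

(** * The second coordinate *)

Section AxisBoth.
Variables d d' : B -> B.
Hypothesis dd' : sphere_iso d d'.
Hypothesis d_axis : axis d.
Hypothesis d'_axis : axis d'.
Let d'd := sphere_iso_sym dd'.

Lemma cmod_cpart a : rnorm a = 1 -> cmod (cpart (d a)) = cmod (cpart a).
Proof.
move=> a1; apply/eqP; rewrite eq_le (cmod_cpart_le dd')// andbT.
by have := cmod_cpart_le d'd d'_axis (iso_unit dd' a1); rewrite (isoK dd').
Qed.

Lemma rnorm_dpart a : rnorm a = 1 -> rnorm (dpart (d a)) = rnorm (dpart a).
Proof.
move=> a1; have := rnorm_split (d a); have := rnorm_split a.
by rewrite a1 (iso_unit dd' a1) cmod_cpart// => {1}-> /addrI.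
Qed.

Lemma cpart_d a mu : rnorm a = 1 -> cmod mu = 1 ->
  cpart a = (cmod (cpart a))%:C * mu ->
  cpart (d a) = (cmod (cpart a))%:C * axis_phase d mu.
Proof.
move=> a1 mu1 aE; rewrite -(cmod_cpart a1); apply: dot_eq_cmod.
  exact: (cmod_axis_phase dd').
have := axis_phase_dist dd' d_axis a1 mu1 aE; rewrite -(cmod_cpart a1) => k.
have := cmodD_sqr (cpart (d a)) (- axis_phase d mu).
have -> : cmod (cpart (d a) - axis_phase d mu) = 1 - cmod (cpart (d a)) by norm_lra.
rewrite cmodN (cmod_axis_phase dd')// dotNr dotC; norm_nra.
Qed.

Lemma axis_phaseK mu : cmod mu = 1 -> axis_phase d' (axis_phase d mu) = mu.
Proof.
move=> mu1; rewrite /axis_phase -/(axis_phase d mu) -(axis_image d_axis)// (isoK dd') ?cpart_mk//.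
exact: rnorm_axis.
Qed.

(** The phase [u] moves in a 1-Lipschitz way, by comparing [u h] and [v h] for one
    peaking function [h].  Different first phases are allowed, hence with
    [p] and [q] sharing [u] this also shows that the image of [u] does not depend
    on [mu]. *)
Lemma face_rel_u_lip p q p' q' : face_rel d p p' -> face_rel d q q' ->
  fx p = fx q -> cmod (fu p' - fu q') <= cmod (fu p - fu q).
Proof.
move=> pp' qq' xE; have x'E := same_x dd' pp' qq' xE.
have [h [h1 hx _]] := regular_peak A_regular (ltr01 : 0 < 1 :> R) (fxch p)
  openT (Logic.I : setT (fx p)).
have hy : ev h (fx q) = 1 by rewrite -xE.
have [a1 pa] := face_point_d h1 hx; have [b1 qb] := face_point_d h1 hy.
set a := mk 0 _ in a1 pa; set b := mk 0 _ in b1 qb.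
have [_] := supf_max1 (iso_unit dd' a1) ((pp' _ a1).1 pa).
have [_] := supf_max1 (iso_unit dd' b1) ((qq' _ b1).1 qb).
rewrite !rnorm_dpart// !dpart_mk !rnormZ_ev !fu1 h1 mulr1 rmorph1 !mul1r -x'E.
move=> qE pE; have := rnorm_ev_le (dpart (d a) - dpart (d b)) (fx p').
rewrite evB pE qE => /le_trans; apply.
have := rnorm_split (d a - d b); rewrite cpartB dpartB (iso_dist dd')//.
have -> : rnorm (a - b) = cmod (fu p - fu q).
  rewrite rnorm_split cpartB dpartB !cpart_mk !dpart_mk subrr cmod0 add0r.
  by rewrite -scalerBl rnormZ_ev h1 mulr1.
by move=> ->; rewrite lerDr cmod_ge0.
Qed.

(** A 1-Lipschitz map of the circle that commutes with the antipode is an isometry,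
    hence preserves the inner product. *)
Lemma face_rel_u_dot p q p' q' : face_rel d p p' -> face_rel d q q' ->
  fx p = fx q -> dot (fu p') (fu q') = dot (fu p) (fu q).
Proof.
have main p0 q0 p0' q0' : face_rel d p0 p0' -> face_rel d q0 q0' ->
    fx p0 = fx q0 -> dot (fu p0) (fu q0) <= dot (fu p0') (fu q0').
  move=> pp' qq' xE; have := face_rel_u_lip pp' qq' xE.
  have := cmodD_sqr (fu p0) (- fu q0); have := cmodD_sqr (fu p0') (- fu q0').
  rewrite !cmodN !fu1 !dotNr => k1 k2 k3.
  have : cmod (fu p0' - fu q0') ^+ 2 <= cmod (fu p0 - fu q0) ^+ 2.
    by rewrite ler_pXn2r// nnegrE cmod_ge0.
  rewrite k1 k2; norm_lra.
move=> pp' qq' xE; apply/eqP; rewrite eq_le (main p q)// andbT.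
have /= := main _ _ _ _ pp' (face_rel_opp dd' qq') xE.
by rewrite !dotNr lerN2.
Qed.

(** Choose the face [q'] over [fx p'] whose phase is opposite to that of [z'], and
    let [q] be its preimage.  With [r] the norm of [D a] and [w] the phase of [q],
    the point [b] with [C b = C a] and [D b = r w h] lies in [q], so [d b] lies in
    [q'] and is at distance at least [r + |z'|] from [d a].  Hence so is [b] from
    [a], for every peaking [h], and [peak_bound] converts this into
    information on [z]. *)
Lemma dpart_phase a p p' : rnorm a = 1 -> face_rel d p p' ->
  exists q q', [/\ face_rel d q q', fx q = fx p, fx q' = fx p' &
    let z := ev (dpart a) (fx p) in let z' := ev (dpart (d a)) (fx p') in
    [/\ z' = - ((cmod z')%:C * fu q'), cmod z' <= cmod z &
      cmod z' = cmod z -> z = - ((cmod z)%:C * fu q)]].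
Proof.
move=> a1 pp'; set z := ev (dpart a) _; set z' := ev (dpart (d a)) _.
have [mu mu1 aE] := polar (cpart a); have [w' w'1 z'E] := polar z'.
pose q' := Face (cmod_axis_phase dd' d_axis mu1) (cmodN1 w'1) (fxch p').
have [q q'q] := face_rel_exists q' d'd.
have qq' : face_rel d q q' := face_rel_sym d'd q'q.
have xE : fx q = fx p.
  exact: same_x d'd q'q (face_rel_sym dd' pp') (erefl : fx q' = fx p').
have muE : fmu q = mu by rewrite (face_rel_mu d'd d'_axis q'q) axis_phaseK.
exists q, q'; split=> //=; set r := rnorm (dpart a).
have r0 : 0 <= r := rnorm_ge0 _.
have zr : cmod z <= r := rnorm_ev_le _ _.
have L h : rnorm h = 1 -> ev h (fx p) = 1 ->
    cmod z' + r <= rnorm (dpart a + (- (r%:C * fu q)) *: h).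
  move=> h1 hx; pose b := mk (cpart a) ((r%:C * fu q) *: h).
  have rb : rnorm (dpart b) = r.
    by rewrite dpart_mk rnormZ_ev h1 mulr1 cmod_scaled ?fu1.
  have b1 : rnorm b = 1 by rewrite rnorm_split rb cpart_mk -rnorm_split.
  have qb : supf q b = 1.
    rewrite -b1; apply/supf_maxP; rewrite rb cpart_mk dpart_mk muE; split=> //.
    by rewrite evZ xE hx mulr1.
  have [cb db] := supf_max1 (iso_unit dd' b1) ((qq' _ b1).1 qb).
  rewrite rnorm_dpart// rb /= in db.
  have dabE : rnorm (a - b) = rnorm (dpart a + (- (r%:C * fu q)) *: h).
    rewrite rnorm_split cpartB dpartB cpart_mk dpart_mk subrr cmod0 add0r.
    by rewrite scaleNr.
  rewrite -dabE -(iso_dist dd')// rnorm_split cpartB dpartB.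
  have -> : cpart (d a) = cpart (d b).
    by rewrite !(cpart_d _ mu1) ?cpart_mk.
  rewrite subrr cmod0 add0r; apply: le_trans (rnorm_ev_le _ (fx p')).
  have z'r : z' - ev (dpart (d b)) (fx p') = (cmod z' + r)%:C * w'.
    by rewrite db mulrN opprK {1}z'E rmorphD/= mulrDl.
  by rewrite evB z'r cmod_scaled// addr_ge0// cmod_ge0.
have vr : cmod (- (r%:C * fu q)) = r by rewrite cmodN cmod_scaled ?fu1.
have hr : cmod (2^-1%:C * - (r%:C * fu q)) = r / 2.
  by rewrite cmodM vr cmod_real ger0_norm// mulrC.
have z0 := cmod_ge0 z; have z'0 := cmod_ge0 z'.
have zz : r = 0 -> z = - ((cmod z)%:C * fu q).
  move=> rE; have -> : z = 0.
    apply: cmod_eq0; apply/eqP; rewrite eq_le z0 andbT; norm_lra.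
  by rewrite cmod0 mul0r oppr0.
split; first by rewrite mulrN opprK.
  have [] := peak_bound A_regular (fxch p) L; rewrite -/z -/r ?vr.
  - norm_lra.
  - norm_lra.
  - have := cmodD z (2^-1%:C * - (r%:C * fu q)); rewrite hr; norm_lra.
move=> zE; have [] := peak_bound A_regular (fxch p) L; rewrite -/z -/r ?vr.
- move=> k; have -> : z = 0.
    apply: cmod_eq0; norm_lra.
  by rewrite cmod0 mul0r oppr0.
- by move=> k; apply: zz; norm_lra.
move=> k; have [r_gt0|r_le0] := ltP 0 r; last by apply: zz; norm_lra.
rewrite -mulrN; apply: (@cmodD_eq R _ (2^-1%:C * - (r%:C * fu q))).
- by rewrite cmodN fu1.
- by rewrite hr -mulrN mulrA -rmorphM/= (mulrC _ r).
- by rewrite hr divr_gt0.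
- by rewrite hr; norm_lra.
Qed.

End AxisBoth.

(** [dpart_phase] for [d] and for its inverse gives equality of the moduli; then
    both values are negative multiples of corresponding phases. *)
Lemma dot_dpart d d' a p p' : sphere_iso d d' -> axis d -> axis d' ->
  rnorm a = 1 -> face_rel d p p' ->
  dot (fu p') (ev (dpart (d a)) (fx p')) = dot (fu p) (ev (dpart a) (fx p)).
Proof.
move=> dd' d_axis d'_axis a1 pp'; have d'd := sphere_iso_sym dd'.
have [q [q' [qq' qx q'x [z'E z'z zE]]]] := dpart_phase dd' d_axis d'_axis a1 pp'.
have [s [s' [_ _ _ [_ zz' _]]]] := dpart_phase d'd d'_axis d_axis
  (iso_unit dd' a1) (face_rel_sym dd' pp').
rewrite (isoK dd')// in zz'.
have cE : cmod (ev (dpart (d a)) (fx p')) = cmod (ev (dpart a) (fx p)).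
  by apply/eqP; rewrite eq_le z'z.
rewrite z'E (zE cE) cE !dotNr !dotZr.
by rewrite (face_rel_u_dot dd' d_axis d'_axis pp' qq')// qx.
Qed.

Lemma dot_cpart d d' a mu : sphere_iso d d' -> axis d -> axis d' ->
  rnorm a = 1 -> cmod mu = 1 ->
  dot (axis_phase d mu) (cpart (d a)) = dot mu (cpart a).
Proof.
move=> dd' d_axis d'_axis a1 mu1; have [nu nu1 aE] := polar (cpart a).
rewrite (cpart_d dd' d_axis d'_axis a1 nu1 aE) {2}aE !dotZr.
by rewrite (dot_axis_phase dd').
Qed.

(** * Extension of sphere isometries *)

Definition extends (d : B -> B) := exists F : B -> B,
  [/\ real_linear F, is_isometry F, is_surjective F &
      forall a, rnorm a = 1 -> F a = d a].

Definition rlinear (phi : B -> R) := forall (r : R) a b,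
  phi (r%:C *: a + b) = r * phi a + phi b.

(** For the homogeneous extension [F a = |a| d (a / |a|)] one gets
    [psi (F a) = phi a] for every pair, so the defect of real linearity of [F] is
    killed by all [psi].  Being isometric then follows from [|F a| = |a|]. *)
Lemma extends_of_functionals d d' (P : (B -> R) -> (B -> R) -> Prop) :
  sphere_iso d d' ->
  (forall phi psi, P phi psi -> [/\ rlinear phi, rlinear psi &
     forall a, rnorm a = 1 -> psi (d a) = phi a]) ->
  (forall b, (forall phi psi, P phi psi -> psi b = 0) -> b = 0) ->
  extends d.
Proof.
move=> dd' Plin Psep.
have rlin0 phi : rlinear phi -> phi 0 = 0.
  by move=> lin; have := lin 1 0 0; rewrite scaler0 addr0 mul1r; lra.
have rlinZ phi (r : R) a : rlinear phi -> phi (r%:C *: a) = r * phi a.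
  by move=> lin; have := lin r a 0; rewrite addr0 (rlin0 _ lin) addr0.
have rlinB phi a b : rlinear phi -> phi (a - b) = phi a - phi b.
  move=> lin; have := lin (-1) b a.
  by rewrite rmorphN1 scaleN1r addrC => ->; rewrite mulN1r addrC.
have nrm1 a : a <> 0 -> rnorm ((rnorm a)^-1%:C *: a) = 1.
  move=> a0; have ap := rnorm_gt0 a0.
  by rewrite rnormZ_B cmod_real ger0_norm ?invr_ge0 ?rnorm_ge0// mulVf// gt_eqF.
have nrmK a : a <> 0 -> (rnorm a)%:C *: ((rnorm a)^-1%:C *: a) = a.
  move=> a0; have ap := rnorm_gt0 a0.
  by rewrite scalerA -rmorphM mulfV ?rmorph1 ?scale1r// gt_eqF.
pose F a := (rnorm a)%:C *: d ((rnorm a)^-1%:C *: a).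
have F0 : F 0 = 0 by rewrite /F rnorm0 rmorph0 scale0r.
have Fpsi phi psi a : P phi psi -> psi (F a) = phi a.
  move=> /Plin[lphi lpsi dE]; have [->|a0] := pselect (a = 0).
    by rewrite F0 !rlin0.
  by rewrite /F rlinZ// dE ?nrm1// -rlinZ// nrmK.
have Fnorm a : rnorm (F a) = rnorm a.
  have [->|a0] := pselect (a = 0); first by rewrite F0.
  rewrite /F rnormZ_B (iso_unit dd') ?nrm1// mulr1 cmod_real ger0_norm//.
  exact: rnorm_ge0.
have Flin : real_linear F.
  move=> r a b; apply/eqP; rewrite -subr_eq0; apply/eqP/Psep => phi psi Ppp.
  have [lphi lpsi _] := Plin _ _ Ppp.
  by rewrite rlinB// lpsi !(Fpsi _ _ _ Ppp) lphi subrr.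
exists F; split => //.
- move=> a b; have FB : F a - F b = F (a - b).
    have := Flin (-1) b a; rewrite rmorphN1 !scaleN1r addrC => ->.
    by rewrite addrC.
  by rewrite FB !rnormE Fnorm.
- move=> b; have [->|b0] := pselect (b = 0); first by exists 0.
  have d1 := iso_unitV dd' (nrm1 _ b0); have bp := rnorm_gt0 b0.
  set c := d' _ in d1.
  have cb : rnorm ((rnorm b)%:C *: c) = rnorm b.
    by rewrite rnormZ_B d1 mulr1 cmod_real ger0_norm// ltW.
  exists ((rnorm b)%:C *: c); rewrite /F cb scalerA -rmorphM mulVf ?gt_eqF//.
  by rewrite rmorph1 scale1r /c (isoKV dd') ?nrm1// nrmK.
- by move=> a a1; rewrite /F a1 invr1 rmorph1 !scale1r.
Qed.

Lemma axis_sym d d' : sphere_iso d d' -> axis d -> axis d'.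
Proof.
move=> dd' dax; apply: (axis_all (sphere_iso_sym dd') (cmod_axis_phase dd' dax (cmod1 R))).
by rewrite -(axis_image dax) ?cmod1// (isoK dd') ?dpart_mk// rnorm_axis ?cmod1.
Qed.

(** The functionals of the two coordinates, taken separately, correspond under
    [d]; this covers [A = 0], where no face exists. *)
Lemma extends_axis d d' : sphere_iso d d' -> axis d -> extends d.
Proof.
move=> dd' dax; have d'ax := axis_sym dd' dax; have d'd := sphere_iso_sym dd'.
apply: (@extends_of_functionals d d' (fun phi psi =>
  (exists2 mu, cmod mu = 1 & phi = (fun a => dot mu (cpart a)) /\
     psi = (fun a => dot (axis_phase d mu) (cpart a))) \/
  (exists p p', [/\ face_rel d p p',
     phi = (fun a => dot (fu p) (ev (dpart a) (fx p))) &
     psi = (fun a => dot (fu p') (ev (dpart a) (fx p')))]))) => //.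
  move=> _ _ [[mu mu1 [-> ->]]|[p [p' [pp' -> ->]]]]; split.
  - by move=> r a b; rewrite cpartD cpartZ dotDr dotZr.
  - by move=> r a b; rewrite cpartD cpartZ dotDr dotZr.
  - by move=> a a1; exact: (dot_cpart dd').
  - by move=> r a b; rewrite dpartD dpartZ evD evZ dotDr dotZr.
  - by move=> r a b; rewrite dpartD dpartZ evD evZ dotDr dotZr.
  - by move=> a a1; exact: (dot_dpart dd').
move=> b bP; have cb : cpart b = 0.
  apply: dot_neq0 => u u1; have u1' := cmod_axis_phase d'd d'ax u1.
  apply: (bP (fun a => dot (axis_phase d' u) (cpart a)) (fun a => dot u (cpart a))).
  by left; exists (axis_phase d' u) => //; rewrite (axis_phaseK d'd).
have [[x xch]|none] := pselect (exists x, choquet_boundary A x); last first.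
  by apply: part_eq; rewrite ?cb ?(eq_0_choquet none (dpart b)) /cpart /dpart ?raddf0.
have [p' p'b] := supf_norming b xch; have [p p'p] := face_rel_exists p' d'd.
apply: rnorm_eq0; rewrite -p'b /supf cb dot0r add0r.
apply: (bP (fun a => dot (fu p) (ev (dpart a) (fx p)))
  (fun a => dot (fu p') (ev (dpart a) (fx p')))).
by right; exists p, p'; split=> //; exact: face_rel_sym p'p.
Qed.

(* When the Choquet boundary is a point [x], evaluation at [x] identifies [A] with
   the complex line, with [h] as unit vector, and the summands can be exchanged. *)
Section Swap.
Variables (x : X) (h : A_).
Hypothesis xch : choquet_boundary A x.
Hypothesis x_uniq : forall y, choquet_boundary A y -> y = x.
Hypothesis h1 : rnorm h = 1.
Hypothesis hx : ev h x = 1.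

Definition swap a := mk (ev (dpart a) x) (cpart a *: h).

Lemma rnorm_ev_singleton f : rnorm f = cmod (ev f x).
Proof.
apply/eqP; rewrite eq_le rnorm_ev_le andbT.
have [p] := supf_norming (mk 0 f) xch.
rewrite supf_mk rnorm_mk cmod0 dot0r !add0r => <-; rewrite (x_uniq (fxch p)).
by have := dot_le (fu p) (ev f x); rewrite fu1 mul1r.
Qed.

Lemma ev_singleton f : ev f x *: h = f.
Proof.
apply/eqP; rewrite -subr_eq0; apply/eqP/rnorm_eq0.
by rewrite rnorm_ev_singleton evB evZ hx mulr1 subrr cmod0.
Qed.

Lemma swapK : involutive swap.
Proof.
by move=> a; apply: part_eq; rewrite /swap !(cpart_mk, dpart_mk) ?evZ ?hx
  ?mulr1// ev_singleton.
Qed.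

Lemma rnorm_swap a : rnorm (swap a) = rnorm a.
Proof.
rewrite /swap rnorm_mk rnormZ_ev h1 mulr1 rnorm_split rnorm_ev_singleton.
exact: addrC.
Qed.

Lemma swap_lin c a b : swap (c *: a + b) = c *: swap a + swap b.
Proof.
have cE a' : cpart (swap a') = ev (dpart a') x by rewrite cpart_mk.
have dE a' : dpart (swap a') = cpart a' *: h by rewrite dpart_mk.
apply: part_eq.
  by rewrite cE (cpartD (c *: swap a)) cpartZ !cE dpartD dpartZ evD evZ.
by rewrite dE (dpartD (c *: swap a)) dpartZ !dE cpartD cpartZ scalerDl scalerA.
Qed.

Lemma swapB a b : swap (a - b) = swap a - swap b.
Proof. by rewrite -scaleN1r addrC swap_lin scaleN1r addrC. Qed.

Lemma swap_iso d d' : sphere_iso d d' -> sphere_iso (swap \o d) (d' \o swap).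
Proof.
move=> dd'; split=> /= [a a1|a a1|a a1|a a1|a b a1 b1].
- by rewrite rnorm_swap (iso_unit dd').
- by rewrite (iso_unitV dd') ?rnorm_swap.
- by rewrite swapK (isoK dd').
- by rewrite (isoKV dd') ?rnorm_swap// swapK.
- by rewrite -swapB rnorm_swap (iso_dist dd').
Qed.

Lemma extends_swap d : extends (swap \o d) -> extends d.
Proof.
move=> [F [Flin Fiso Fsurj Fd]]; exists (swap \o F); split.
- by move=> r a b /=; rewrite Flin swap_lin.
- by move=> a b /=; rewrite -swapB rnormE rnorm_swap -rnormE Fiso.
- by move=> b; have [a aE] := Fsurj (swap b); exists a; rewrite /= aE swapK.
- by move=> a a1 /=; rewrite Fd//= swapK.
Qed.

End Swap.

Lemma sphere_iso_extends d d' : sphere_iso d d' -> extends d.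
Proof.
move=> dd'; have [d1|d1] := pselect (dpart (d (mk 1 0)) = 0).
  exact: (extends_axis dd' (axis_all dd' (cmod1 R) d1)).
have [[x xch]|none] := pselect (exists x, choquet_boundary A x); last first.
  by case: d1; exact: eq_0_choquet.
have x_uniq := off_axis_singleton dd' xch (cmod1 R) d1.
have [h [h1 hx _]] := regular_peak A_regular (ltr01 : 0 < 1 :> R) xch
  openT (Logic.I : setT x).
apply: (@extends_swap x h xch x_uniq h1 hx).
have sdd' := swap_iso xch x_uniq h1 hx dd'.
apply: (extends_axis sdd'); apply: (axis_all sdd' (cmod1 R)) => /=.
rewrite /swap dpart_mk; have [->|//] := axis_or dd' xch (cmod1 R).
by rewrite scale0r.
Qed.

End Faces.

Lemma sphere_map_total (R : realType) (B : normedModType R[i])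
    (Delta : unit_sphere B -> unit_sphere B) :
  sphere_isometry Delta -> is_surjective Delta ->
  exists d d' : B -> B, sphere_iso d d' /\
    forall a : unit_sphere B, d (val a) = val (Delta a).
Proof.
move=> Diso /choice[Delta' DK].
have DK' a : Delta' (Delta a) = a.
  apply/val_inj/eqP; rewrite -subr_eq0 -normr_eq0 -Diso DK.
  by rewrite subrr normr0.
have S1 (a : unit_sphere B) : rnorm (val a) = 1.
  by apply/complexI; rewrite -rnormE; have /set_mem := valP a.
have S1' (a : B) : rnorm a = 1 -> a \in unit_sphere B.
  by move=> a1; apply/mem_set; rewrite /unit_sphere/= rnormE a1.
pose ext (f : unit_sphere B -> unit_sphere B) (a : B) : B :=
  if insub a is Some s then val (f s) else a.
have extE f (s : unit_sphere B) : ext f (val s) = val (f s).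
  by rewrite /ext valK.
have lift a : rnorm a = 1 -> exists s : unit_sphere B, val s = a.
  by move=> a1; exists (exist _ a (S1' a a1)).
exists (ext Delta), (ext Delta'); split; last by move=> a; exact: extE.
split=> [a /lift[s <-]|a /lift[s <-]|a /lift[s <-]|a /lift[s <-]|
         a b /lift[s <-] /lift[t <-]]; rewrite ?extE ?DK ?DK' ?S1//.
by apply/complexI; rewrite -!rnormE Diso.
Qed.

Theorem theorem1 (R : realType) (B : normedModType R[i])
    (X : topologicalType)
    (X_locally_compact : locally_compact [set: X])
    (X_hausdorff : hausdorff_space X)
    (A : submodClosed (C0 R X)) (A_regular : extremely_C_regular A)
    (I : {linear subspace_of A -> B})
    (D : {linear B -> subspace_of A})
    (C : {linear B -> R[i]^o})
    (I_bounded : bounded_near I (nbhs (0 : subspace_of A)))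
    (D_bounded : bounded_near D (nbhs (0 : B)))
    (C_bounded : bounded_near C (nbhs (0 : B)))
    (DI : forall f : subspace_of A, D (I f) = f)
    (CI : forall f : subspace_of A, C (I f) = 0)
    (B_norm : forall a : B, `|a| = `|C a| + `|D a|)
    (e_exists : exists e : B, [/\ D e = 0, C e = 1 & `|e| = 1])
    (Delta : unit_sphere B -> unit_sphere B)
    (Delta_isometry : sphere_isometry Delta)
    (Delta_surjective : is_surjective Delta) :
  exists F : B -> B,
    [/\ real_linear F, is_isometry F, is_surjective F &
        forall a : unit_sphere B, F (val a) = val (Delta a)].
Proof.
have [e [De Ce _]] := e_exists.
have [d [d' [dd' dE]]] := sphere_map_total Delta_isometry Delta_surjective.
have [F [Flin Fiso Fsurj Fd]] :=
  sphere_iso_extends X_hausdorff A_regular DI CI B_norm De Ce dd'.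
exists F; split=> // a; rewrite -dE Fd//.
by apply/complexI; rewrite -rnormE; have /set_mem := valP a.
Qed.
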